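(* Assume the localisation setting described in the context, with $$A:=\overline{\operatorname{skew}\Big(\alpha M_0\begin{pmatrix}\mathcal L_{X_0}&0\\0&-\mathcal L_{X_0}^*\end{pmatrix}\Big)+\begin{pmatrix}0&-\mathring d^{\,*}\\ \mathring d&0\end{pmatrix}}$$ on $H=L_2^k(\Omega)\times L_2^{k+1}(\Omega)$, $$B_1:=\overline{\iota_{U_1}^*\operatorname{skew}\Big(\alpha M_0\begin{pmatrix}\mathcal L_{X_0}&0\\0&-\mathcal L_{X_0}^*\end{pmatrix}\Big)\iota_{U_1}+\begin{pmatrix}0&-\mathring d_{\tilde\Omega}^{\,*}\\ \mathring d_{\tilde\Omega}&0\end{pmatrix}}$$ on $U_1=L_2^k(\tilde\Omega)\times L_2^{k+1}(\tilde\Omega)$, and $$B_2:=\begin{pmatrix}0&-\mathring d_{\hat\Omega}^{\,*}\\ \mathring d_{\hat\Omega}&0\end{pmatrix}$$ on $U_2=L_2^k(\hat\Omega)\times L_2^{k+1}(\hat\Omega)$. If $B_1$ and $B_2$ are skew-selfadjoint operators on $U_1$ and $U_2$, respectively, then $A$ is skew-selfadjoint on $H$.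
   Context: Definitions. $(M,g)$ is a smooth oriented Riemannian manifold of odd dimension $n$, $1\le k<n$. For open $G\subseteq M$: $\Lambda^k(G)$ are the smooth $k$-forms on $G$, $\Lambda_c^k(G)$ those with compact support, $L_2^k(G)$ the real Hilbert space of square-integrable $k$-forms, $\ast$ the Hodge star, $T^0_{1,c}(G)$ the compactly supported smooth vector fields. For a smooth vector field $X$ let $\mathcal L_{X,c}$ and $d_c$ be the Lie derivative along $X$ and the exterior derivative with domain $\Lambda^k_c(G)$, as operators $L_2^k(G)\to L_2^k(G)$ and $L_2^k(G)\to L_2^{k+1}(G)$ (all degrees). On $G$ define $\mathcal L_X:=-\ast\mathcal L_{X,c}^*\ast$, $\mathring d_G:=\overline{d_c}$, $d:=(-1)^{n-k}\ast d_c^*\ast:L_2^k(G)\to L_2^{k+1}(G)$; $\mathring d:=\mathring d_\Omega$. For an operator $T$: $\operatorname{sym}T:=\frac12\overline{(T+T^* )}$ and $\operatorname{skew}T:=\frac12\overline{(T-T^* )}$; a densely defined closed $T$ is quasi-skew-selfadjoint if $\operatorname{dom}(T)=\operatorname{dom}(T^* )$ and $\operatorname{sym}T$ is bounded. For bounded $R$ leaving $\operatorname{dom}(T)$ invariant, $[R,T]:=RT-TR=:-[T,R]$ on $\operatorname{dom}(T)$; ''continuous'' means bounded on the domain. Localisation setting. $\Omega\subseteq M$ is open, $\Omega=\hat\Omega\cup\tilde\Omega$ with $\tilde\Omega,\hat\Omega\subseteq\Omega$ open. $M_0,M_1\in L(H)$ are local operators (e.g. multiplication operators), $M_0$ is selfadjoint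 with $M_0\ge c>0$. $X_0$ is a smooth vector field on $M$ and $\alpha\in L_\infty(\Omega;\mathbb{R})$ (identified with its multiplication operator); $X_0$ and $\alpha$ are supported in $\tilde\Omega$ and vanish on $\hat\Omega$. In $A$, $\mathcal L_{X_0}$ acts on forms on $\Omega$. The following Hypotheses are satisfied with $G=\tilde\Omega$ and with $G=\hat\Omega$ (with $M_0$ restricted to forms on $G$): (i) $\sup\{\|\nabla_YX_0\|_\infty:Y\in T^0_{1,c}(G),\|Y\|_\infty\le1\}<\infty$; (ii) $\mathcal L_{X_0}$ is quasi-skew-selfadjoint; (iii) $M_0$ leaves $\operatorname{dom}(\mathcal L_{X_0})\times\operatorname{dom}(\mathcal L_{X_0})$ invariant and $\alpha$ leaves $\operatorname{dom}(\mathcal L_{X_0})$ invariant; (iv) $\left[\begin{pmatrix}\mathcal L_{X_0}&0\\0&\mathcal L_{X_0}\end{pmatrix},M_0\right]$ and $[\mathcal L_{X_0},\alpha]$ are continuous; (v) for all small $\varepsilon>0$ and both signs, $(1\pm\varepsilon\mathcal L_{X_0})[\Lambda^k(G)\cap\operatorname{dom}(\mathcal L_{X_0})\cap\operatorname{dom}(d)]\cap\operatorname{dom}(\mathring d_G)$ is dense in $\operatorname{dom}(\mathring d_G)$ in the graph norm; (vi) $M_0\alpha=\alpha M_0$. $U_1,U_2$ are regarded as closed subspaces of $H$ via extension by $0$; $\iota_{U_j}:U_j\to H$ is the canonical embedding. $\phi:\Omega\to[0,1]$ is smooth with $\operatorname{supp}\phi\subseteq\tilde\Omega$ and $\operatorname{supp}X_0\subseteq\{\phi=1\}$;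 $S_1$ and $S_2$ are the operators on $H$ of multiplication by $\phi$ and by $1-\phi$. For $j=1,2$ the following is assumed: $A$ (on $H$) and $B_j$ (on $U_j$) are densely defined and closed; $A^*$ leaves $U_j$ invariant; $\operatorname{ran}(S_j),\operatorname{ran}(S_j^* )\subseteq U_j$; $S_j[\operatorname{dom}(A)]\subseteq\operatorname{dom}(A)$; $[S_j,A]$ is continuous; and there exists an extension operator $E_j:\operatorname{dom}(B_j)\to\operatorname{dom}(A)$ with $\iota_{U_j}^*E_jx=x$ and $\iota_{U_j}^*AE_jx=B_jx$ for all $x\in\operatorname{dom}(B_j)$. *)

(* Defs.v *)
From HB Require Import structures.
From mathcomp Require Import all_boot all_order all_algebra.
From mathcomp Require Import perm.
From mathcomp Require Import all_classical all_reals all_analysis.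
From mathcomp Require Import measurable_realfun ring lra.
Set Implicit Arguments.
Unset Strict Implicit.
Unset Printing Implicit Defensive.
Import Order.TTheory GRing.Theory Num.Theory.
Import numFieldNormedType.Exports.
Local Open Scope classical_set_scope.
Local Open Scope ring_scope.

(** * Calculus on ['rV[R]_n] *)

Section calculus.
Context {R : realType} {n : nat}.
Implicit Types (f : 'rV[R]_n -> R) (U : set 'rV[R]_n).

Definition pder (i : 'I_n) f : 'rV[R]_n -> R := fun x => 'D_(delta_mx 0 i) f x.

Definition pders (s : seq 'I_n) f : 'rV[R]_n -> R := foldr pder f s.

(* [U] is always open below, so that the values of [f] off [U] are irrelevant. *)
Definition smooth_on U f := forall (s : seq 'I_n) x, U x ->
  {for x, continuous (pders s f)} /\
  forall i, derivable (pders s f) x (delta_mx 0 i).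

End calculus.

(* Integral over R^n of a nonnegative Borel function, as an iterated Lebesgue
   integral (Tonelli). *)
Fixpoint iint {R : realType} (n : nat) : ('rV[R]_n -> \bar R) -> \bar R :=
  match n with
  | 0 => fun f => f 0
  | m.+1 => fun f => (\int[@lebesgue_measure R]_t
      iint (fun v : 'rV[R]_m => f (row_mx (t%:M : 'rV_1) v)))%E
  end.

(** * Oriented Riemannian manifolds *)

Notation borel T := (g_sigma_algebraType (@open T)).

(* An atlas indexed by [nat] (with possibly empty domains) amounts to second
   countability.  [cinv j] is the inverse of the chart [chart j]; it and
   [chart j] carry information only on [chart j @` cdom j] and [cdom j]. *)
Record atlas (R : realType) (n : nat) (M : ptopologicalType) := Atlas {
  cdom : nat -> set M;
  chart : nat -> M -> 'rV[R]_n;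
  cinv : nat -> 'rV[R]_n -> M;
  cdom_open : forall j, open (cdom j);
  cimg_open : forall j, open (chart j @` cdom j);
  chartK : forall j p, cdom j p -> cinv j (chart j p) = p;
  chart_continuous : forall j p, cdom j p -> {for p, continuous (chart j)};
  cinv_continuous : forall j x, (chart j @` cdom j) x ->
    {for x, continuous (cinv j)};
  cdom_cover : forall p, exists j, cdom j p }.

Arguments cdom {R n M} a.
Arguments chart {R n M} a.
Arguments cinv {R n M} a.

(* [jac at i j p] a b is the derivative of the b-th coordinate of chart [j]
   along the a-th coordinate of chart [i], at [p]. *)
Definition jac (R : realType) (n : nat) (M : ptopologicalType)
    (A : atlas R n M) (i j : nat) (p : M) : 'M[R]_n :=
  \matrix_(a, b) pder a (fun x => chart A j (cinv A i x) 0 b) (chart A i p).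

(* [gram j p] is the Gram matrix at [p] of the coordinate fields of chart
   [j]; [vol] is the Riemannian measure, which [vol_chart] determines. *)
Record riemannian (R : realType) (n : nat) := Riemannian {
  points :> ptopologicalType;
  points_hausdorff : hausdorff_space points;
  charts : atlas R n points;
  charts_smooth : forall i j b,
    smooth_on (chart charts i @` (cdom charts i `&` cdom charts j))
      (fun x => chart charts j (cinv charts i x) 0 b);
  charts_oriented : forall i j p, cdom charts i p -> cdom charts j p ->
    0 < \det (jac charts i j p);
  gram : nat -> points -> 'M[R]_n;
  gram_sym : forall j p, cdom charts j p -> (gram j p)^T = gram j p;
  gram_gt0 : forall j p (v : 'rV[R]_n), cdom charts j p -> v != 0 ->
    0 < (v *m gram j p *m v^T) 0 0;
  gram_smooth : forall j a b, smooth_on (chart charts j @` cdom charts j)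
    (fun x => gram j (cinv charts j x) a b);
  gram_change : forall i j p, cdom charts i p -> cdom charts j p ->
    gram i p = jac charts i j p *m gram j p *m (jac charts i j p)^T;
  vol : {measure set (borel points) -> \bar R};
  vol_chart : forall j (A : set (borel points)), measurable A ->
    A `<=` cdom charts j ->
    vol A = iint (fun x => (Num.sqrt (\det (gram j (cinv charts j x))) *
                            \1_(chart charts j @` A) x)%:E) }.

Arguments charts {R n} r.
Arguments gram {R n} r.
Arguments vol {R n} r.

Record opens (T : topologicalType) := Opens {
  opens_set :> set T;
  opensP : open opens_set }.

Section fields_and_forms.
Context {R : realType} {n : nat} (M : riemannian R n).
Local Notation cdom := (cdom (charts M)).
Local Notation chart := (chart (charts M)).
Local Notation cinv := (cinv (charts M)).
Local Notation jac := (jac (charts M)).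

Lemma cover_bool (p : M) : exists j, `[< cdom j p >].
Proof. by have [j jp] := cdom_cover (charts M) p; exists j; apply/asboolP. Qed.

(* The chart through which T_pM is identified with R^n. *)
Definition atp (p : M) : nat := ex_minn (cover_bool p).

Lemma atpP (p : M) : cdom (atp p) p.
Proof. by rewrite /atp; case: ex_minnP => j /asboolP. Qed.

(** Tangent vectors and alternating forms at [p] are given by their components
    in the chart [atp p]; [vcomp j] and [fcomp j] are the components in
    chart [j]. *)

Definition vfield := M -> 'rV[R]_n.

Definition kform (k : nat) := M -> {ffun k.-tuple 'I_n -> R}.

Definition vcomp (j : nat) (X : vfield) (p : M) : 'rV[R]_n :=
  X p *m jac (atp p) j p.

Definition fcomp (k j : nat) (w : kform k) (p : M) (I : k.-tuple 'I_n) : R :=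
  \sum_(J : k.-tuple 'I_n)
    (\prod_(a < k) jac j (atp p) p (tnth I a) (tnth J a)) * w p J.

Definition smooth_vfield (G : set M) (X : vfield) := forall j b,
  smooth_on (chart j @` (G `&` cdom j)) (fun x => vcomp j X (cinv j x) 0 b).

Definition alternating_on (k : nat) (G : set M) (w : kform k) :=
  forall p (I : k.-tuple 'I_n) (s : 'S_k), G p ->
    w p [tuple tnth I (s a) | a < k] = (-1) ^+ s * w p I.

Definition smooth_form (k : nat) (G : set M) (w : kform k) :=
  alternating_on G w /\ forall j I,
  smooth_on (chart j @` (G `&` cdom j)) (fun x => fcomp j w (cinv j x) I).

Definition smooth_fun (G : set M) (f : M -> R) := forall j,
  smooth_on (chart j @` (G `&` cdom j)) (fun x => f (cinv j x)).

Definition compact_support_in (V : zmodType) (G : set M) (u : M -> V) :=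
  exists K, [/\ compact K, K `<=` G & forall p, G p -> ~ K p -> u p = 0].

(* Partial derivatives at [p], in the chart [atp p]. *)
Definition dpart (p : M) (a : 'I_n) (h : nat -> M -> R) : R :=
  pder a (fun x => h (atp p) (cinv (atp p) x)) (chart (atp p) p).

Definition ext_d (k : nat) (w : kform k) : kform k.+1 := fun p =>
  [ffun I : k.+1.-tuple 'I_n => \sum_(a < k.+1) (-1) ^+ a *
     dpart p (tnth I a)
       (fun j q => fcomp j w q [tuple tnth I (lift a b) | b < k])].

Definition lie_d (k : nat) (X : vfield) (w : kform k) : kform k := fun p =>
  [ffun I : k.-tuple 'I_n =>
     (\sum_(a < n) X p 0 a * dpart p a (fun j q => fcomp j w q I)) +
     \sum_(b < k) \sum_(c < n)
       dpart p (tnth I b) (fun j q => vcomp j X q 0 c) *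
       w p [tuple if a == b then c else tnth I a | a < k]].

Definition gmx (p : M) : 'M[R]_n := gram M (atp p) p.

Definition ginv (p : M) : 'M[R]_n := invmx (gmx p).

Definition vnorm (p : M) (v : 'rV[R]_n) : R :=
  Num.sqrt ((v *m gmx p *m v^T) 0 0).

Definition christoffel (p : M) (c a b : 'I_n) : R :=
  2^-1 * \sum_(d < n) ginv p c d *
    (dpart p a (fun j q => gram M j q d b) +
     dpart p b (fun j q => gram M j q d a) -
     dpart p d (fun j q => gram M j q a b)).

(* The Levi-Civita derivative of [X] along [Y]. *)
Definition nabla (Y X : vfield) : vfield := fun p =>
  \row_c \sum_(a < n) Y p 0 a *
    (dpart p a (fun j q => vcomp j X q 0 c) +
     \sum_(b < n) christoffel p c a b * X p 0 b).

(* The inner product of k-covectors: the factor 1/k! makes the wedge products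
   of an orthonormal coframe orthonormal. *)
Definition fip (k : nat) (p : M) (u v : {ffun k.-tuple 'I_n -> R}) : R :=
  (k`!%:R)^-1 * \sum_(I : k.-tuple 'I_n) \sum_(J : k.-tuple 'I_n)
    (\prod_(a < k) ginv p (tnth I a) (tnth J a)) * (u I * v J).

(* The Levi-Civita symbol: for [s] of size [n], the sign of the permutation
   [s] of ['I_n], and 0 if [s] has a repetition. *)
Definition levi_civita (s : seq 'I_n) : R :=
  \det (\matrix_(a < n, b < n) (onth s a == Some b)%:R : 'M[R]_n).

(* The Hodge star, from degree [k] to degree [l = n - k]; its convention is
   u /\ *v = <u, v> dvol. *)
Definition hodge (k l : nat) (w : kform k) : kform l := fun p =>
  [ffun J : l.-tuple 'I_n => (k`!%:R)^-1 * Num.sqrt (\det (gmx p)) *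
     \sum_(I : k.-tuple 'I_n) \sum_(I' : k.-tuple 'I_n)
       (\prod_(a < k) ginv p (tnth I a) (tnth I' a)) * w p I' *
       levi_civita (I ++ J)].

End fields_and_forms.

(** * Measurability and positivity of the pointwise inner product *)

Section gram.
Variable R : realType.

Definition posdef n (g : 'M[R]_n) :=
  g^T = g /\ forall v : 'rV[R]_n, v != 0 -> 0 < (v *m g *m v^T) 0 0.

Lemma posdef_factor n (g : 'M[R]_n) :
  posdef g -> exists2 F : 'M[R]_n, F \in unitmx & g = F *m F^T.
Proof.
elim: n g => [|n IH] g [gT gp].
  by exists 1%:M; [exact: unitmx1 | rewrite [LHS]flatmx0 [RHS]flatmx0].
rewrite -[n.+1]/(1 + n)%N in g gT gp *.
pose a := ulsubmx g 0 0; pose b := ursubmx g; pose C := drsubmx g.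
have ul : ulsubmx g = a%:M by rewrite [LHS]mx11_scalar.
have dl : dlsubmx g = b^T by rewrite /b -{1}gT -trmx_ursub.
have gE : g = block_mx a%:M b b^T C by rewrite -ul -dl submxK.
have CT : C^T = C by rewrite /C -[RHS](congr1 drsubmx gT) -trmx_drsub.
have a0 : 0 < a.
  have := gp (row_mx 1%:M 0) _; rewrite gE tr_row_mx mul_row_block.
  rewrite mul_row_col trmx0 mulmx0 addr0 mul0mx addr0 mul1mx trmx1 mulmx1 mxE.
  by apply; apply/eqP => /(congr1 lsubmx); rewrite row_mxKl linear0; apply/eqP/matrix_nonzero1.
have [|F' F'u CE] := IH (C - a^-1 *: (b^T *m b)).
  split; first by rewrite linearB linearZ /= trmx_mul trmxK CT.
  move=> v v0; have := gp (row_mx (- a^-1 *: (v *m b^T)) v) _.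
  have -> : row_mx (- a^-1 *: (v *m b^T)) v *m g *m (row_mx (- a^-1 *: (v *m b^T)) v)^T =
     v *m (C - a^-1 *: (b^T *m b)) *m v^T.
    rewrite gE tr_row_mx mul_row_block mul_row_col.
    rewrite mul_mx_scalar scalerA mulrN mulfV ?gt_eqF// scaleN1r addNr mul0mx add0r.
    rewrite mulmxBr -scalemxAl -scalemxAr addrC scaleNr; congr (_ *m _).
    by rewrite mulmxA.
  apply; apply: contraNneq v0 => /(congr1 rsubmx).
  by rewrite row_mxKr linear0 => ->.
have sa : Num.sqrt a != 0 by rewrite gt_eqF ?sqrtr_gt0.
exists (block_mx (Num.sqrt a)%:M 0 ((Num.sqrt a)^-1 *: b^T) F').
  rewrite unitmxE det_lblock unitrM det_scalar1 unitfE sa/=.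
  by rewrite -unitmxE.
rewrite gE tr_block_mx mulmx_block; congr block_mx.
- by rewrite tr_scalar_mx trmx0 mulmx0 addr0 -scalar_mxM -expr2 sqr_sqrtr// ltW.
- by rewrite mul0mx addr0 linearZ /= trmxK mul_scalar_mx scalerA mulfV// scale1r.
- by rewrite tr_scalar_mx mul_mx_scalar trmx0 mulmx0 addr0 scalerA mulfV// scale1r.
- rewrite linearZ /= trmxK -scalemxAl -scalemxAr scalerA -invfM -expr2.
  by rewrite sqr_sqrtr ?ltW// -CE addrC subrK.
Qed.

End gram.

Section fip_theory.
Variables (R : realType) (n k : nat) (Q P : 'M[R]_n).
Hypotheses (Pu : P \in unitmx) (QE : Q = P^T *m P).
Implicit Types u v w : {ffun k.-tuple 'I_n -> R}.

Let gip u v := (k`!%:R)^-1 *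
  \sum_(I : k.-tuple 'I_n) \sum_(J : k.-tuple 'I_n)
    (\prod_(a < k) Q (tnth I a) (tnth J a)) * (u I * v J).

Let hat (S : 'M[R]_n) u : {ffun k.-tuple 'I_n -> R} :=
  [ffun K : k.-tuple 'I_n =>
  \sum_(I : k.-tuple 'I_n) (\prod_(a < k) S (tnth K a) (tnth I a)) * u I].

Let sum_prod (A B : 'M[R]_n) (I J : k.-tuple 'I_n) :
  \sum_(K : k.-tuple 'I_n) (\prod_(a < k) A (tnth I a) (tnth K a)) *
    (\prod_(a < k) B (tnth K a) (tnth J a)) =
  \prod_(a < k) (A *m B) (tnth I a) (tnth J a).
Proof.
under [RHS]eq_bigr do rewrite mxE.
rewrite (bigA_distr_bigA (fun a c => A (tnth I a) c * B c (tnth J a))).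
rewrite (reindex (fun f : {ffun 'I_k -> 'I_n} => [tuple f a | a < k])) /=.
  apply: eq_bigr => f _; rewrite -big_split /=.
  by apply: eq_bigr => a _; rewrite !tnth_mktuple.
exists (fun K => [ffun a => tnth K a]) => f _.
  by apply/ffunP => a; rewrite ffunE tnth_mktuple.
by apply: eq_from_tnth => a; rewrite tnth_mktuple ffunE.
Qed.

Let gipE u v : gip u v = (k`!%:R)^-1 *
  \sum_(K : k.-tuple 'I_n) hat P u K * hat P v K.
Proof.
congr (_ * _).
under [RHS]eq_bigr => K _.
  rewrite !ffunE big_distrl/=.
  under eq_bigr do rewrite big_distrr/=.
  over.
rewrite [RHS]exchange_big /=; apply: eq_bigr => I _.
rewrite [RHS]exchange_big /=; apply: eq_bigr => J _.
rewrite QE -sum_prod big_distrl /=; apply: eq_bigr => K _.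
under eq_bigr do rewrite mxE.
by rewrite mulrACA.
Qed.

Let hatK u : hat (invmx P) (hat P u) = u.
Proof.
apply/ffunP => I; rewrite ffunE.
under eq_bigr => K _ do rewrite ffunE big_distrr/=.
rewrite exchange_big /= (bigD1 I)//= [X in _ + X]big1 ?addr0.
  under eq_bigr do rewrite mulrA.
  rewrite -big_distrl /= sum_prod mulVmx// big1 ?mul1r// => a _.
  by rewrite mxE eqxx.
move=> J JI; under eq_bigr do rewrite mulrA.
rewrite -big_distrl /= sum_prod mulVmx//.
have [a Ia] : exists a, tnth I a != tnth J a.
  apply/existsP; apply: contraNT JI => /existsPn h; apply/eqP/eq_from_tnth => a.
  by have := h a; rewrite negbK => /eqP.
by rewrite (bigD1 a)//= mxE (negbTE Ia) !mul0r.
Qed.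

Let ck : (0 : R) < (k`!%:R)^-1.
Proof. by rewrite invr_gt0 ltr0n fact_gt0. Qed.

Lemma gip_ge0 u : 0 <= gip u u.
Proof.
rewrite gipE mulr_ge0 ?(ltW ck)//; apply: sumr_ge0 => K _.
by rewrite -expr2 sqr_ge0.
Qed.

Lemma gip_eq0 u : gip u u = 0 -> u = 0.
Proof.
rewrite gipE => /eqP; rewrite mulf_eq0 gt_eqF//= psumr_eq0; last first.
  by move=> K _; rewrite -expr2 sqr_ge0.
move=> /allP h; rewrite -[u]hatK; apply/ffunP => I; rewrite !ffunE big1// => K _.
have := h K; rewrite mem_index_enum => /(_ isT) /=.
by rewrite -expr2 sqrf_eq0 => /eqP ->; rewrite mulr0.
Qed.

Lemma gipC u v : gip u v = gip v u.
Proof. by rewrite !gipE; congr (_ * _); apply: eq_bigr => K _; rewrite mulrC. Qed.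

Lemma gip_linear a u v w : gip (a *: u + v) w = a * gip u w + gip v w.
Proof.
rewrite mulrCA -mulrDr; congr (_ * _).
rewrite big_distrr/= -big_split/=; apply: eq_bigr => I _.
rewrite big_distrr/= -big_split/=; apply: eq_bigr => J _.
by rewrite !ffunE mulrDl mulrDr -!mulrA mulrCA.
Qed.

Lemma gip_bound u v : `|gip u v| <= gip u u + gip v v.
Proof.
rewrite !gipE -mulrDr normrM gtr0_norm// ler_wpM2l ?(ltW ck)//.
rewrite -big_split/=; apply: le_trans (ler_norm_sum _ _ _) _.
apply: ler_sum => K _; rewrite normrM.
set x := hat P u K; set y := hat P v K.
rewrite -!expr2 -[x ^+ 2]real_normK ?num_real// -[y ^+ 2]real_normK ?num_real//.
have := normr_ge0 x; have := normr_ge0 y; move: `|x| `|y| => s t; nra.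
Qed.

End fip_theory.

Section measurability.
Context {R : realType} {n : nat} (M : riemannian R n).
Local Notation cdom := (cdom (charts M)).
Local Notation chart := (chart (charts M)).
Local Notation cinv := (cinv (charts M)).

Lemma open_borel (T : ptopologicalType) (U : set T) :
  open U -> measurable (U : set (borel T)).
Proof. by move=> oU; apply: sub_sigma_algebra. Qed.

Lemma open_continuous_borel (T : ptopologicalType) (U : set T) (f : T -> R) :
  open U -> (forall p, U p -> {for p, continuous f}) ->
  measurable_fun (U : set (borel T)) f.
Proof.
move=> oU cf; apply: (measurability _ (RGenOpens.measurableE R)).
move=> _ [_ [x [y ->]] <-]; apply: open_borel.
set V := `]x, y[%classic; have oV : open V by exact: interval_open.
have -> : U `&` f @^-1` V = U `&` (U `&` f @^-1` V)°.
  apply/seteqP; split=> p [Up h]; split => //.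
    apply: filterI; first exact: open_nbhs_nbhs.
    have Vf : nbhs (f p) V by apply: open_nbhs_nbhs; split=> //; exact: h.2.
    exact: (cf p Up V Vf).
  exact: (interior_subset h).2.
by apply: openI => //; exact: open_interior.
Qed.

Lemma gram_continuous j a b p : cdom j p ->
  {for p, continuous (fun q => gram M j q a b)}.
Proof.
move=> jp.
have := (gram_smooth (r := M) a b [::] (x := chart j p)) _.
case/(_ j); first by exists p.
move=> /= cm _.
have: {for p, continuous ((fun x => gram M j (cinv j x) a b) \o chart j)}.
  by apply: continuous_comp => //; exact: chart_continuous.
rewrite /prop_for /continuous_at /= chartK// => h; apply: cvg_trans h.
apply: near_eq_cvg; near=> q; rewrite /= chartK//.
by near: q; apply: open_nbhs_nbhs; split => //; exact: cdom_open.
Unshelve. all: by end_near. Qed.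

Let D j : set (borel M) := [set p | atp p = j].

Let DE j : D j = cdom j `\` \bigcup_(i < j) cdom i.
Proof.
apply/seteqP; split=> p; rewrite /D /= /atp; case: ex_minnP => m /asboolP mp h.
  move=> <-; split=> // -[i /= im ip].
  by have := h i; rewrite leqNgt im/= => /(_ (asboolT ip)).
move=> [jp jn]; apply/eqP; rewrite eqn_leq (h j (asboolT jp))/= leqNgt.
by apply/negP => mj; apply: jn; exists m.
Qed.

Let mD j : measurable (D j).
Proof.
rewrite DE; apply: measurableD; first by apply: open_borel; apply: cdom_open.
by apply: bigcup_measurable => i _; by apply: open_borel; apply: cdom_open.
Qed.

Lemma measurable_gmx a b :
  measurable_fun (setT : set (borel M)) (fun p => gmx p a b).
Proof.
have -> : (setT : set (borel M)) = \bigcup_j D j.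
  by apply/seteqP; split=> // p _; exists (atp p).
apply/measurable_fun_bigcup => // j.
apply: (@eq_measurable_fun _ _ (borel M) R (D j) (fun p => gram M j p a b)).
  by move=> p; rewrite inE /gmx => ->.
apply: (@measurable_funS _ _ (borel M) R (cdom j) (D j)); first by apply: open_borel; apply: cdom_open.
  by rewrite DE => p [].
apply: open_continuous_borel; first exact: cdom_open.
exact: gram_continuous.
Qed.

Lemma measurable_det m (A : borel M -> 'M[R]_m) :
  (forall a b, measurable_fun setT (fun p => A p a b)) ->
  measurable_fun setT (fun p => \det (A p)).
Proof.
move=> mA; apply: measurable_sum => s; apply: measurable_funM => //.
by apply: measurable_prod => i _; exact: mA.
Qed.

Lemma gmx_posdef (p : M) : posdef (gmx p).
Proof.
split; first exact: (gram_sym (atpP p)).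
by move=> v; exact: (gram_gt0 (atpP p)).
Qed.

Lemma gmx_factor (p : M) :
  exists2 P : 'M[R]_n, P \in unitmx & ginv p = P^T *m P.
Proof.
have [F Fu gE] := posdef_factor (gmx_posdef p).
exists (invmx F); first by rewrite unitmx_inv.
rewrite /ginv gE trmx_inv.
apply: (can_inj (mulmxK (_ : F *m F^T \in unitmx))).
  by rewrite unitmx_mul unitmx_tr Fu.
rewrite mulVmx ?unitmx_mul ?unitmx_tr ?Fu// -!mulmxA (mulmxA _ F).
by rewrite mulVmx// mul1mx mulVmx// unitmx_tr.
Qed.

Lemma det_gmx_gt0 (p : M) : 0 < \det (gmx p).
Proof.
have [F Fu ->] := posdef_factor (gmx_posdef p).
by rewrite det_mulmx det_tr -expr2 exprn_even_gt0 //= -unitfE -unitmxE.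
Qed.

Lemma measurable_ginv a b :
  measurable_fun (setT : set (borel M)) (fun p => ginv p a b).
Proof.
have -> : (fun p => ginv p a b) = fun p : borel M =>
    (\det (gmx p)) `^ (-1) * cofactor (gmx p) b a.
  apply/funext => p; rewrite /ginv /invmx unitmxE unitfE gt_eqF ?det_gmx_gt0//=.
  by rewrite !mxE powR_inv1// ltW// det_gmx_gt0.
apply: measurable_funM.
  apply: (measurableT_comp (measurable_powR (-1))).
  by apply: measurable_det; exact: measurable_gmx.
apply: measurable_funM => //; apply: measurable_det => i j.
by under eq_fun do rewrite !mxE; exact: measurable_gmx.
Qed.

Lemma measurable_fip k (G : set (borel M)) (u v : kform M k) : measurable G ->
  (forall I, measurable_fun G (fun p => u p I)) ->
  (forall I, measurable_fun G (fun p => v p I)) ->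
  measurable_fun G (fun p => fip p (u p) (v p)).
Proof.
move=> mG mu mv; apply: measurable_funM => //.
apply: measurable_sum => I; apply: measurable_sum => J.
apply: measurable_funM; last exact: measurable_funM.
apply: measurable_prod => a _.
by apply: measurable_funS (measurable_ginv _ _).
Qed.

End measurability.

(** * Inner product spaces *)

HB.mixin Record Lmodule_isPreHilbert (R : realType) V of GRing.Lmodule R V := {
  ip : V -> V -> R;
  ipC : forall x y, ip x y = ip y x;
  ip_linear : forall a x y z, ip (a *: x + y) z = a * ip x z + ip y z;
  ip_ge0 : forall x, 0 <= ip x x;
  ip_eq0 : forall x, ip x x = 0 -> x = 0 }.

#[short(type="preHilbertType")]
HB.structure Definition PreHilbert (R : realType) :=
  {V of GRing.Lmodule R V & Lmodule_isPreHilbert R V}.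

Definition nrm (R : realType) (V : preHilbertType R) (x : V) : R :=
  Num.sqrt (ip x x).

Section product_preHilbert.
Variables (R : realType) (V W : preHilbertType R).

Let pip (x y : V * W) : R := ip x.1 y.1 + ip x.2 y.2.

Let pipC x y : pip x y = pip y x.
Proof. by rewrite /pip ipC [X in _ + X]ipC. Qed.

Let pip_linear a x y z : pip (a *: x + y) z = a * pip x z + pip y z.
Proof. by rewrite /pip !ip_linear mulrDr addrACA. Qed.

Let pip_ge0 x : 0 <= pip x x.
Proof. by rewrite addr_ge0// ip_ge0. Qed.

Let pip_eq0 x : pip x x = 0 -> x = 0.
Proof.
move/eqP; rewrite paddr_eq0 ?ip_ge0// => /andP[/eqP x1 /eqP x2].
by case: x x1 x2 => u v /= /ip_eq0 -> /ip_eq0 ->.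
Qed.

HB.instance Definition _ := Lmodule_isPreHilbert.Build R (V * W)%type
  pipC pip_linear pip_ge0 pip_eq0.

End product_preHilbert.

(** * Square-integrable forms *)

Section almost_all.
Context {R : realType} {n : nat} {M : riemannian R n}.
Implicit Types P Q : M -> Prop.

Definition almost_all P := {ae vol M, forall p, P p}.

Let ae_filter : Filter (almost_everywhere (vol M)).
Proof. exact: ae_filter_ringOfSetsType. Qed.

Lemma almost_allT P : (forall p, P p) -> almost_all P.
Proof. by move=> h; apply: aeW. Qed.

Lemma almost_allS P Q : (forall p, P p -> Q p) -> almost_all P -> almost_all Q.
Proof. exact: (@filterS _ _ ae_filter). Qed.

Lemma almost_all2 P1 P2 Q : (forall p, P1 p -> P2 p -> Q p) ->
  almost_all P1 -> almost_all P2 -> almost_all Q.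
Proof. exact: (@filterS2 _ _ ae_filter). Qed.

End almost_all.

Section L2.
Context {R : realType} {n : nat} (M : riemannian R n).
Variables (G : opens M) (k : nat).

Let mG : measurable (G : set (borel M)).
Proof. by apply: open_borel; apply: opensP. Qed.

(* Square-integrable sections over [G]; their values off [G] are irrelevant. *)
Definition L2_section (w : kform M k) :=
  [/\ alternating_on G w,
      forall I, measurable_fun (G : set (borel M)) (fun p => w p I) &
      (\int[vol M]_(p in G) (fip p (w p) (w p))%:E < +oo)%E].

Definition L2_section_pred : {pred kform M k} := fun w => `[< L2_section w >].

Let fipC p (u v : {ffun k.-tuple 'I_n -> R}) :
  fip (M := M) p u v = fip p v u.
Proof. by have [P Pu PE] := gmx_factor p; exact: gipC PE _ _. Qed.

Let fip_linear p a (u v w : {ffun k.-tuple 'I_n -> R}) :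
  fip (M := M) p (a *: u + v) w = a * fip p u w + fip p v w.
Proof. exact: gip_linear. Qed.

Let fip_ge0 p (u : {ffun k.-tuple 'I_n -> R}) : 0 <= fip (M := M) p u u.
Proof. by have [P Pu PE] := gmx_factor p; exact: gip_ge0 PE _. Qed.

Let fip_bound p (u v : {ffun k.-tuple 'I_n -> R}) :
  `|fip (M := M) p u v| <= fip p u u + fip p v v.
Proof. by have [P Pu PE] := gmx_factor p; exact: gip_bound PE _ _. Qed.

Let fip0 p (v : {ffun k.-tuple 'I_n -> R}) : fip (M := M) p 0 v = 0.
Proof. by have := fip_linear p 1 0 0 v; rewrite scaler0 addr0 mul1r; lra. Qed.

Let fipZ p a (u v : {ffun k.-tuple 'I_n -> R}) :
  fip (M := M) p (a *: u) v = a * fip p u v.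
Proof. by have := fip_linear p a u 0 v; rewrite addr0 fip0 addr0. Qed.

Let measurable_fip2 (u v : kform M k) : L2_section u -> L2_section v ->
  measurable_fun (G : set (borel M)) (fun p => (fip p (u p) (v p))%:E).
Proof.
by move=> [_ mu _] [_ mv _]; apply/measurable_EFinP; exact: measurable_fip.
Qed.

Let integrable_sq (u : kform M k) : L2_section u ->
  (vol M).-integrable G (fun p => (fip p (u p) (u p))%:E).
Proof.
move=> Lu; apply/integrableP; split; first exact: measurable_fip2.
under eq_integral => p _ do rewrite /= ger0_norm//; by case: Lu.
Qed.

Let integrable_fip (u v : kform M k) : L2_section u -> L2_section v ->
  (vol M).-integrable G (fun p => (fip p (u p) (v p))%:E).
Proof.
move=> Lu Lv.
apply: (le_integrable mG _ _ (integrableD mG (integrable_sq Lu) (integrable_sq Lv))).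
  exact: measurable_fip2.
move=> p _ /=; rewrite lee_fin; apply: le_trans (fip_bound _ _ _) _.
by rewrite ger0_norm// addr_ge0.
Qed.

Let L2_submod_closed : submod_closed L2_section_pred.
Proof.
split.
  apply/asboolP; split.
  - by move=> p I s _; rewrite !ffunE mulr0.
  - move=> I; have -> : (fun p : borel M => (0 : kform M k) p I) = cst 0;
      [by apply/funext => p; rewrite /= ffunE | exact: measurable_cst].
  - by rewrite integral0_eq// => p _; rewrite fip0.
move=> a u v /asboolP Lu /asboolP Lv; apply/asboolP.
have Luv : measurable_fun (G : set (borel M))
    (fun p => (fip p ((a *: u + v) p) ((a *: u + v) p))%:E).
  apply/measurable_EFinP; apply: measurable_fip => // I;
  (have -> : (fun p => (a *: u + v) p I) = (fun p : borel M => a * u p I + v p I)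
     by apply/funext => p; rewrite /= !ffunE);
  case: Lu Lv => _ mu _ [_ mv _]; by apply: measurable_funD => //; exact: measurable_funM.
split.
- case: Lu Lv => au _ _ [av _ _] p I s Gp.
  by rewrite /= !ffunE au// av// mulrDr mulrCA.
- move=> I.
  have -> : (fun p => (a *: u + v) p I) = (fun p : borel M => a * u p I + v p I).
    by apply/funext => p; rewrite /= !ffunE.
  by case: Lu Lv => _ mu _ [_ mv _]; apply: measurable_funD => //; exact: measurable_funM.
have int2 := integrableD mG
  (integrableZl mG (3 * a ^+ 2) (integrable_sq Lu))
  (integrableZl mG 3 (integrable_sq Lv)).
have /integrableP[_] : (vol M).-integrable G
    (fun p => (fip p ((a *: u + v) p) ((a *: u + v) p))%:E).
  apply: (le_integrable mG Luv _ int2) => p _ /=.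
  rewrite lee_fin !ger0_norm//; last first.
    by rewrite addr_ge0// mulr_ge0// mulr_ge0// sqr_ge0.
  have := fip_bound p (a *: u p) (v p); rewrite ler_norml => /andP[_].
  rewrite -[(a *: u + v) p]/(a *: u p + v p) fip_linear ![fip p _ (_ + _)]fipC !fip_linear !fipZ.
  rewrite [fip p _ (a *: _)]fipC fipZ [fip p (v p) (u p)]fipC; nra.
under eq_integral => p _ do rewrite /= ger0_norm//; exact.
Qed.

HB.instance Definition _ := GRing.isSubmodClosed.Build R (kform M k)
  L2_section_pred L2_submod_closed.

Record L2sec := L2Sec {
  L2val :> kform M k;
  L2valP : L2val \in L2_section_pred }.

HB.instance Definition _ := [isSub for L2val].
HB.instance Definition _ := [Choice of L2sec by <:].
HB.instance Definition _ := [SubChoice_isSubLmodule of L2sec by <:].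

Definition ae_eq_on (u v : kform M k) :=
  almost_all (fun p => opens_set G p -> u p = v p).

Definition ae_eq_L2sec (u v : L2sec) := `[< ae_eq_on u v >].

Let ae_refl : reflexive ae_eq_L2sec.
Proof. by move=> u; apply/asboolP; exact: almost_allT. Qed.

Let ae_sym : symmetric ae_eq_L2sec.
Proof.
by move=> u v; apply/asboolP/asboolP; apply: almost_allS => p h Gp; rewrite h.
Qed.

Let ae_trans : transitive ae_eq_L2sec.
Proof.
move=> v u w /asboolP uv /asboolP vw; apply/asboolP.
by apply: almost_all2 uv vw => p h h' Gp; rewrite h// h'.
Qed.

Canonical ae_eq_L2sec_equiv :=
  EquivRel ae_eq_L2sec ae_refl ae_sym ae_trans.

Local Open Scope quotient_scope.

(* The space of square-integrable k-forms on [G], modulo equality a.e. *)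
Definition L2 : Type := {eq_quot ae_eq_L2sec}.
HB.instance Definition _ := Choice.on L2.
HB.instance Definition _ := EqQuotient.on L2.

Definition L2repr (x : L2) : kform M k := L2val (repr x).

Let L2P (x y : L2) : ae_eq_on (L2repr x) (L2repr y) -> x = y.
Proof.
move=> h; rewrite -[x]reprK -[y]reprK; apply/eqmodP => /=.
by apply/asboolP.
Qed.

Let repr_pi (u : L2sec) : ae_eq_on (L2repr (\pi_L2 u)) u.
Proof.
have /eqmodP/asboolP : \pi_L2 (repr (\pi_L2 u)) = \pi_L2 u by rewrite reprK.
exact.
Qed.

Definition L2_zero : L2 := \pi_L2 (0 : L2sec).
Definition L2_opp (x : L2) : L2 := \pi_L2 (- repr x).
Definition L2_add (x y : L2) : L2 := \pi_L2 (repr x + repr y).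
Definition L2_scale (a : R) (x : L2) : L2 := \pi_L2 (a *: repr x).

Let pi_ae (u v : L2sec) : ae_eq_on u v -> \pi_L2 u = \pi_L2 v.
Proof. by move=> h; apply/eqmodP; apply/asboolP. Qed.

Let addE u v : L2_add (\pi_L2 u) (\pi_L2 v) = \pi_L2 (u + v).
Proof.
apply: pi_ae; apply: almost_all2 (repr_pi u) (repr_pi v) => p h1 h2 Gp.
by rewrite /= -[LHS]/(L2repr (\pi_L2 u) p + L2repr (\pi_L2 v) p) h1// h2.
Qed.

Let oppE u : L2_opp (\pi_L2 u) = \pi_L2 (- u).
Proof.
apply: pi_ae; apply: almost_allS (repr_pi u) => p h Gp.
by rewrite /= -[LHS]/(- L2repr (\pi_L2 u) p) h.
Qed.

Let scaleE a u : L2_scale a (\pi_L2 u) = \pi_L2 (a *: u).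
Proof.
apply: pi_ae; apply: almost_allS (repr_pi u) => p h Gp.
by rewrite /= -[LHS]/(a *: L2repr (\pi_L2 u) p) h.
Qed.

Let addA : associative L2_add.
Proof.
move=> x y z; rewrite -[x]reprK -[y]reprK -[z]reprK.
move: (repr x) (repr y) (repr z) => u v w.
by rewrite (addE v w) (addE u) (addE u v) (addE _ w) addrA.
Qed.

Let addC : commutative L2_add.
Proof. by move=> x y; rewrite -[x]reprK -[y]reprK; move: (repr x) (repr y) => u v; rewrite (addE u v) (addE v u) addrC. Qed.

Let add0 : left_id L2_zero L2_add.
Proof. by move=> x; rewrite -[x]reprK; move: (repr x) => u; rewrite addE add0r. Qed.

Let addN : left_inverse L2_zero L2_opp L2_add.
Proof. by move=> x; rewrite -[x]reprK; move: (repr x) => u; rewrite oppE addE addNr. Qed.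

HB.instance Definition _ := GRing.isZmodule.Build L2 addA addC add0 addN.

Let L2addE u v : \pi_L2 u + \pi_L2 v = \pi_L2 (u + v).
Proof. exact: addE. Qed.

Let scaleA a b x : L2_scale a (L2_scale b x) = L2_scale (a * b) x.
Proof. by rewrite -[x]reprK; move: (repr x) => u; rewrite (scaleE b u) (scaleE a) (scaleE _ u) scalerA. Qed.

Let scale1 : left_id 1 L2_scale.
Proof. by move=> x; rewrite -[x]reprK; move: (repr x) => u; rewrite scaleE scale1r. Qed.

Let scaleDr : right_distributive L2_scale +%R.
Proof.
by move=> a x y; rewrite -[x]reprK -[y]reprK; move: (repr x) (repr y) => u v; rewrite (L2addE u v) (scaleE a) (scaleE a u) (scaleE a v) L2addE scalerDr.
Qed.

Let scaleDl x : {morph L2_scale^~ x : a b / a + b}.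
Proof. by move=> a b; rewrite -[x]reprK; move: (repr x) => u; rewrite (scaleE _ u) (scaleE a) (scaleE b) scalerDl -L2addE. Qed.

HB.instance Definition _ := GRing.Zmodule_isLmodule.Build R L2
  scaleA scale1 scaleDr scaleDl.

Let L2scaleE a u : a *: \pi_L2 u = \pi_L2 (a *: u).
Proof. exact: scaleE. Qed.

Let L2secP (u : L2sec) : L2_section u.
Proof. by have /asboolP := L2valP u. Qed.

Definition L2ip (x y : L2) : R :=
  \int[vol M]_(p in G) fip p (L2repr x p) (L2repr y p).

Let L2ipE u v : L2ip (\pi_L2 u) (\pi_L2 v) = \int[vol M]_(p in G) fip p (L2val u p) (L2val v p).
Proof.
rewrite /L2ip /Rintegral; congr fine.
apply: ae_eq_integral => //; [exact: (measurable_fip2 (L2secP _) (L2secP _)) ..|].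
apply: almost_all2 (repr_pi u) (repr_pi v) => p h1 h2 Gp.
by rewrite h1// h2.
Qed.

Let L2ipC x y : L2ip x y = L2ip y x.
Proof. by rewrite /L2ip; apply: eq_Rintegral => p _; rewrite fipC. Qed.

Let L2ip_linear a x y z : L2ip (a *: x + y) z = a * L2ip x z + L2ip y z.
Proof.
rewrite -[x]reprK -[y]reprK -[z]reprK.
move: (repr x) (repr y) (repr z) => u v w.
rewrite L2scaleE L2addE !L2ipE.
rewrite -RintegralZl//; last exact: (integrable_fip (L2secP u) (L2secP w)).
rewrite -RintegralD//; last 2 first.
- exact: (integrableZl mG a (integrable_fip (L2secP u) (L2secP w))).
- exact: (integrable_fip (L2secP v) (L2secP w)).
by apply: eq_Rintegral => p _; rewrite -fip_linear.
Qed.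

Let L2ip_ge0 x : 0 <= L2ip x x.
Proof. by apply: Rintegral_ge0 => p _; exact: fip_ge0. Qed.

Let L2ip_eq0 x : L2ip x x = 0 -> x = 0.
Proof.
rewrite -[x]reprK; move: (repr x) => u; rewrite L2ipE /Rintegral => h.
have h0 : (\int[vol M]_(p in G) (fip p (L2val u p) (L2val u p))%:E = 0)%E.
  rewrite -[LHS]fineK ?h// ge0_fin_numE; first by case: (L2secP u).
  by apply: integral_ge0 => p _; rewrite lee_fin fip_ge0.
apply: pi_ae.
have /ae_eq_integral_abs : (\int[vol M]_(p in G) `|(fip p (L2val u p) (L2val u p))%:E| = 0)%E.
  by under eq_integral => p _ do rewrite /= ger0_norm//; exact.
move=> /(_ mG (measurable_fip2 (L2secP u) (L2secP u))).
apply: almost_allS => p /= hp Gp; have [] := hp Gp.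
have [P Pu PE] := gmx_factor p.
by move/(gip_eq0 Pu PE).
Qed.

HB.instance Definition _ := Lmodule_isPreHilbert.Build R L2
  L2ipC L2ip_linear L2ip_ge0 L2ip_eq0.

(* The class of [w], when [w] is square-integrable on [G]. *)
Definition toL2 (w : kform M k) : L2 := \pi_L2 (insubd (0 : L2sec) w).

(* [x] is the class of [w]. *)
Definition represents (x : L2) (w : kform M k) := ae_eq_on (L2repr x) w.

End L2.

(** * Unbounded operators, as graphs *)

Section operators.
Context {R : realType}.
Implicit Types U V W : preHilbertType R.

Definition opgraph V W (f : V -> W) : set (V * W) := [set xy | xy.2 = f xy.1].

Definition opdom V W (T : set (V * W)) : set V := [set x | exists y, T (x, y)].

Definition opclosure V W (T : set (V * W)) : set (V * W) :=
  [set xy | forall e, 0 < e -> exists2 uv, T uv & nrm (xy - uv) < e].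

Definition adj V W (T : set (V * W)) : set (W * V) :=
  [set yz | forall xw, T xw -> ip xw.2 yz.1 = ip xw.1 yz.2].

Definition opadd V W (S T : set (V * W)) : set (V * W) :=
  [set xy | exists u v, [/\ S (xy.1, u), T (xy.1, v) & xy.2 = u + v]].

Definition opscale V W (a : R) (T : set (V * W)) : set (V * W) :=
  [set xy | exists2 y, T (xy.1, y) & xy.2 = a *: y].

Definition opcomp U V W (S : set (V * W)) (T : set (U * V)) : set (U * W) :=
  [set xz | exists2 y, T (xz.1, y) & S (y, xz.2)].

Definition opsym V (T : set (V * V)) : set (V * V) :=
  opscale 2^-1 (opclosure (opadd T (adj T))).

Definition opskew V (T : set (V * V)) : set (V * V) :=
  opscale 2^-1 (opclosure (opadd T (opscale (-1) (adj T)))).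

(* [N T - T N], on the [x] in the domain of [T] with [N x] in it as well. *)
Definition opcomm V (N : V -> V) (T : set (V * V)) : set (V * V) :=
  [set xw | exists y z, [/\ T (xw.1, y), T (N xw.1, z) & xw.2 = N y - z]].

Definition opdiag V W (S : set (V * V)) (T : set (W * W)) :
    set ((V * W) * (V * W)) :=
  [set xy | S (xy.1.1, xy.2.1) /\ T (xy.1.2, xy.2.2)].

(* The block operator with rows (0, - D^* ) and (D, 0). *)
Definition opskewblock V W (D : set (V * W)) : set ((V * W) * (V * W)) :=
  [set xy | opscale (-1) (adj D) (xy.1.2, xy.2.1) /\ D (xy.1.1, xy.2.2)].

Definition continuous_op V W (T : set (V * W)) :=
  exists C, forall x y, T (x, y) -> nrm y <= C * nrm x.

Definition linear_op V W (T : set (V * W)) :=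
  [/\ T 0, forall a u v, T u -> T v -> T (a *: u + v) &
      forall x y z, T (x, y) -> T (x, z) -> y = z].

Definition dd_closed V W (T : set (V * W)) :=
  [/\ linear_op T,
      forall x e, 0 < e -> exists2 u, opdom T u & nrm (x - u) < e &
      opclosure T `<=` T].

Definition quasi_skew_selfadjoint V (T : set (V * V)) :=
  [/\ dd_closed T, opdom T = opdom (adj T) & continuous_op (opsym T)].

Definition skew_selfadjoint V (T : set (V * V)) :=
  dd_closed T /\ T = opscale (-1) (adj T).

Definition bounded_linear V W (N : V -> W) :=
  linear N /\ exists C, forall x, nrm (N x) <= C * nrm x.

(* The assumptions of the localisation method for [A] on [V], [B] on the
   subspace [range iota] of [V], and the bounded operator [S] on [V]. *)
Record localisable U V (A : set (V * V)) (B : set (U * U)) (S : V -> V)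
    (iota : U -> V) : Prop := Localisable {
  loc_A : dd_closed A;
  loc_B : dd_closed B;
  loc_adj_invariant : forall x y, adj A (x, y) -> range iota x -> range iota y;
  loc_range : range S `<=` range iota;
  loc_adj_range : forall x y, adj (opgraph S) (x, y) -> range iota y;
  loc_dom : forall x, opdom A x -> opdom A (S x);
  loc_comm : continuous_op (opcomm S A);
  loc_extension : exists E : U -> V,
    (forall a x y, opdom B x -> opdom B y -> E (a *: x + y) = a *: E x + E y) /\
    forall x y, B (x, y) -> exists z,
      [/\ A (E x, z), adj (opgraph iota) (E x, x) & adj (opgraph iota) (z, y)] }.

End operators.

(** * Operators on square-integrable forms *)

Notation Hs G k := (L2 G k * L2 G k.+1)%type.

Section form_operators.
Context {R : realType} {n : nat} {M : riemannian R n}.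
Implicit Types (G : opens M) (k l : nat) (X : vfield M) (f : M -> R).

Definition mulop G k f (x : L2 G k) : L2 G k :=
  toL2 G (fun p => f p *: L2repr x p).

Definition mulopH G k f (x : Hs G k) : Hs G k := (mulop f x.1, mulop f x.2).

(* The Hodge star, for [k + l = n]. *)
Definition star G k l (x : L2 G k) : L2 G l := toL2 G (hodge l (L2repr x)).

Definition smooth_L2 G k (x : L2 G k) :=
  exists2 w : kform M k, smooth_form G w & represents x w.

Definition d_c G k : set (L2 G k * L2 G k.+1) :=
  [set xy | exists w : kform M k, [/\ smooth_form G w, compact_support_in G w,
     represents xy.1 w & represents xy.2 (ext_d w)]].
Arguments d_c : clear implicits.

Definition lie_c X G k : set (L2 G k * L2 G k) :=
  [set xy | exists w : kform M k, [/\ smooth_form G w, compact_support_in G w,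
     represents xy.1 w & represents xy.2 (lie_d X w)]].
Arguments lie_c : clear implicits.

Definition dring G k : set (L2 G k * L2 G k.+1) := opclosure (d_c G k).
Arguments dring : clear implicits.

(* (-1)^(n-k) * d_c^* *, for [k < n]: the adjoint is that of [d_c] from degree
   [n - k - 1] to degree [n - k], here written [(n - k.+1).+1]. *)
Definition dmax G k : set (L2 G k * L2 G k.+1) :=
  opscale ((-1) ^+ (n - k)) (opcomp (opgraph (star k.+1 (k := n - k.+1)))
    (opcomp (adj (d_c G (n - k.+1))) (opgraph (star (n - k.+1).+1 (k := k))))).
Arguments dmax : clear implicits.

(* - * L_{X,c}^* *, for [k <= n]. *)
Definition lieop X G k : set (L2 G k * L2 G k) :=
  opscale (-1) (opcomp (opgraph (star k (k := n - k)))
    (opcomp (adj (lie_c X G (n - k))) (opgraph (star (n - k) (k := k))))).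
Arguments lieop : clear implicits.

(* Extension by 0, for [G] contained in [Om], and restriction. *)
Definition ext0 G Om k (x : L2 G k) : L2 Om k :=
  toL2 Om (fun p => if `[< opens_set G p >] then L2repr x p else 0).

Definition ext0H G Om k (x : Hs G k) : Hs Om k := (ext0 Om x.1, ext0 Om x.2).

Definition restr Om G k (x : L2 Om k) : L2 G k := toL2 G (L2repr x).

Definition restr_op Om G k (N : Hs Om k -> Hs Om k) (x : Hs G k) : Hs G k :=
  (restr G (N (ext0H Om x)).1, restr G (N (ext0H Om x)).2).

(* [N] does not enlarge supports. *)
Definition local_op Om k (N : Hs Om k -> Hs Om k) :=
  forall (V : set M) (x : Hs Om k), open V -> V `<=` Om ->
    let vanishes (y : Hs Om k) :=
      almost_all (fun p => V p -> L2repr y.1 p = 0 /\ L2repr y.2 p = 0) in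
    vanishes x -> vanishes (N x).

Definition L_infty Om (f : M -> R) :=
  measurable_fun (opens_set Om : set (borel M)) f /\
  exists C, almost_all (fun p => opens_set Om p -> `|f p| <= C).

Definition vsupp X : set M := closure [set p | X p != 0].

(* Supports within [Om]; the essential support for the second one. *)
Definition supp_in Om f : set M :=
  opens_set Om `&` closure [set p | opens_set Om p /\ f p != 0].

Definition ess_supp_in Om f : set M :=
  opens_set Om `\` [set p | exists V : set M, [/\ open V, V p &
    almost_all (fun q => V q -> opens_set Om q -> f q = 0)]].

(* Hypotheses (i)-(vi) on [G], with [N] for the restriction of [M_0]; those on
   the Lie derivative as an operator concern both degrees of [Hs G k]. *)
Record lie_hypotheses G k X alpha (N : Hs G k -> Hs G k) : Prop :=
    LieHypotheses {
  lie_nabla_bounded : exists C, forall Y : vfield M, smooth_vfield G Y ->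
    compact_support_in G Y -> (forall p, opens_set G p -> vnorm p (Y p) <= 1) ->
    forall p, opens_set G p -> vnorm p (nabla Y X p) <= C;
  lie_quasi_skew : quasi_skew_selfadjoint (lieop X G k) /\
    quasi_skew_selfadjoint (lieop X G k.+1);
  lie_N_invariant : forall x, opdom (lieop X G k) x.1 ->
    opdom (lieop X G k.+1) x.2 ->
    opdom (lieop X G k) (N x).1 /\ opdom (lieop X G k.+1) (N x).2;
  lie_alpha_invariant :
    (forall x, opdom (lieop X G k) x -> opdom (lieop X G k) (mulop alpha x)) /\
    (forall x, opdom (lieop X G k.+1) x ->
       opdom (lieop X G k.+1) (mulop alpha x));
  lie_comm_N : continuous_op (opcomm N (opdiag (lieop X G k) (lieop X G k.+1)));
  lie_comm_alpha : continuous_op (opcomm (mulop alpha) (lieop X G k)) /\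
    continuous_op (opcomm (mulop alpha) (lieop X G k.+1));
  lie_dense : exists2 e0, 0 < e0 & forall e (b : bool), 0 < e < e0 ->
    forall xy, dring G k xy -> forall eta, 0 < eta ->
    exists uv, [/\ dring G k uv, nrm (xy - uv) < eta & exists w w',
      [/\ smooth_L2 w, opdom (dmax G k) w, lieop X G k (w, w') &
          uv.1 = w + ((-1) ^+ b * e) *: w']];
  lie_N_alpha : forall x, N (mulopH alpha x) = mulopH alpha (N x) }.

Definition lie_part Om k X alpha (N : Hs Om k -> Hs Om k) :
    set (Hs Om k * Hs Om k) :=
  opskew (opcomp (opgraph (mulopH alpha \o N))
    (opdiag (lieop X Om k) (opscale (-1) (adj (lieop X Om k.+1))))).

Definition opA Om k X alpha (N : Hs Om k -> Hs Om k) : set (Hs Om k * Hs Om k) :=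
  opclosure (opadd (lie_part X alpha N) (opskewblock (dring Om k))).

Definition opB1 Om G k X alpha (N : Hs Om k -> Hs Om k) : set (Hs G k * Hs G k) :=
  opclosure (opadd
    (opcomp (adj (opgraph (ext0H (G := G) Om (k := k))))
       (opcomp (lie_part X alpha N) (opgraph (ext0H (G := G) Om (k := k)))))
    (opskewblock (dring G k))).

Definition opB2 G k : set (Hs G k * Hs G k) := opskewblock (dring G k).

End form_operators.

Arguments d_c {R n M} G k _.
Arguments lie_c {R n M} X G k _.
Arguments dring {R n M} G k _.
Arguments dmax {R n M} G k _.
Arguments lieop {R n M} X G k _.
Arguments restr_op {R n M} [Om] G [k] N x.
Arguments opB1 {R n M} [Om] G [k] X alpha N _.
Arguments opB2 {R n M} G k _.

(* Main.v *)
(* Let S1 = phi and S2 = 1 - phi, which are symmetric, and consider the form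
   q(x, y) = <A* x, y> + <x, A* y> on dom A*.  The operator A is
   skew-symmetric, so [S1, A] extends to a bounded symmetric operator; hence S1
   and S2 preserve dom A* and q(S_j x, y) = q(x, S_j y).  As A* leaves U_j
   invariant, the extension operators E_j give S_j x in dom B_j^* with
   B_j^* S_j x = A* S_j x, and B_j^* = - B_j yields q(S_j x, S_j y) = 0.
   Consequently q(S1 S2 x, y) = q(S1 S1 S2 x, y) + q(S1 S2 S2 x, y) = 0, and
   q = 0 because 1 = S1^2 + 2 S1 S2 + S2^2.  So A* is contained in - A** = - A.
   The theorems of Riesz and von Neumann used here rest on the completeness of
   L_2^k (Riesz-Fischer). *)

Require Import Defs.
From mathcomp Require Import all_boot all_order all_algebra.
From mathcomp Require Import all_classical all_reals all_analysis.
From mathcomp Require Import perm measurable_realfun ring lra.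
Set Implicit Arguments.
Unset Strict Implicit.
Unset Printing Implicit Defensive.
Import Order.TTheory GRing.Theory Num.Theory.
Import numFieldNormedType.Exports.
Local Open Scope classical_set_scope.
Local Open Scope ring_scope.

Lemma sub_ffunE (aT : finType) (rT : zmodType) (x y : {ffun aT -> rT}) i :
  (x - y) i = x i - y i.
Proof. by rewrite !ffunE. Qed.

(** * Inner product spaces *)

(** Closes the density arguments below, where the error is [e * C] with [e] arbitrary. Dividing by
    [C + 1] covers the case [C = 0]. *)
Lemma small_eq0 (R : realType) (a C : R) :
  0 <= C -> (forall e, 0 < e -> `|a| <= e * C) -> a = 0.
Proof.
move=> C0 h; apply/eqP; rewrite -normr_eq0; apply/eqP/le_anti.
rewrite normr_ge0 andbT; apply/ler_addgt0Pl => e e0; rewrite addr0.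
have C1 : 0 < C + 1 by rewrite ltr_wpDl.
apply: (le_trans (h (e / (C + 1)) (divr_gt0 e0 C1))).
by rewrite -mulrA ler_piMr ?(ltW e0)// mulrC ler_pdivrMr// mul1r lerDl.
Qed.

Lemma expr16_lt (R : realType) (e : R) : 0 < e -> exists i, 16^-1 ^+ i < e.
Proof.
move=> e0; have : \forall i \near \oo, (16^-1 : R) ^+ i < e.
  have := @cvg_expr R 16^-1 _; rewrite ger0_norm// invf_lt1// ltr1n => /(_ isT).
  move=> /cvgrPdist_lt /(_ e e0); apply: filterS => i.
  by rewrite sub0r normrN ger0_norm ?exprn_ge0.
by case=> i _ /(_ i (leqnn i)) h; exists i.
Qed.

Section preHilbert_theory.
Context {R : realType} {V : preHilbertType R}.
Implicit Types (x y z : V) (a : R).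

Lemma ipDl x y z : ip (x + y) z = ip x z + ip y z.
Proof. by rewrite -[x]scale1r ip_linear mul1r scale1r. Qed.

Lemma ip0l x : ip 0 x = 0.
Proof. by have := ipDl 0 0 x; rewrite addr0; lra. Qed.

Lemma ipZl a x y : ip (a *: x) y = a * ip x y.
Proof. by rewrite -[a *: x]addr0 ip_linear ip0l addr0. Qed.

Lemma ipNl x y : ip (- x) y = - ip x y.
Proof. by rewrite -scaleN1r ipZl mulN1r. Qed.

Lemma ipBl x y z : ip (x - y) z = ip x z - ip y z.
Proof. by rewrite ipDl ipNl. Qed.

Lemma ipDr x y z : ip x (y + z) = ip x y + ip x z.
Proof. by rewrite ipC ipDl ![ip _ x]ipC. Qed.

Lemma ipZr a x y : ip x (a *: y) = a * ip x y.
Proof. by rewrite ipC ipZl ipC. Qed.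

Lemma ipNr x y : ip x (- y) = - ip x y.
Proof. by rewrite ipC ipNl ipC. Qed.

Lemma ipBr x y z : ip x (y - z) = ip x y - ip x z.
Proof. by rewrite ipDr ipNr. Qed.

Lemma ipr_inj (x y : V) : (forall z, ip x z = ip y z) -> x = y.
Proof.
move=> h; apply/eqP; rewrite -subr_eq0; apply/eqP/ip_eq0.
by rewrite ipBl h subrr.
Qed.

Lemma nrm_ge0 x : 0 <= nrm x.
Proof. exact: sqrtr_ge0. Qed.

Lemma sqr_nrm x : nrm x ^+ 2 = ip x x.
Proof. by rewrite sqr_sqrtr// ip_ge0. Qed.

Lemma cauchy_schwarz x y : `|ip x y| <= nrm x * nrm y.
Proof.
rewrite -(@ler_pXn2r _ 2)// ?nnegrE// ?mulr_ge0 ?nrm_ge0//.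
rewrite real_normK ?num_real// exprMn !sqr_nrm.
have [y0|y0] := eqVneq (ip y y) 0.
  by rewrite (ip_eq0 _ y0) ipC !ip0l expr0n mulr0.
have yp : 0 < ip y y by rewrite lt_neqAle eq_sym y0 ip_ge0.
(* This square expands to [ip y y * (ip x x * ip y y - ip x y ^+ 2)]. *)
have := ip_ge0 (ip y y *: x - ip x y *: y).
rewrite !(ipBl, ipBr, ipZl, ipZr) [ip y x]ipC.
by move=> h; rewrite -subr_ge0 -(pmulr_rge0 _ yp); nra.
Qed.

(** By Cauchy-Schwarz. Only the vector [x] has to be approximated, so the lemma applies to a point
    of [opclosure T], with [T] as [D]. *)
Lemma ip_approx_eq0 (D : set V) x y :
  (forall e, 0 < e -> exists2 u, D u & nrm (x - u) < e) ->
  (forall u, D u -> ip u y = 0) -> ip x y = 0.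
Proof.
move=> h D0; apply: (small_eq0 (nrm_ge0 y)) => e /h[u Du xu].
have -> : ip x y = ip (x - u) y by rewrite ipBl (D0 u)// subr0.
by apply: (le_trans (cauchy_schwarz _ _)); rewrite ler_wpM2r ?nrm_ge0// ltW.
Qed.

Lemma nrmD x y : nrm (x + y) <= nrm x + nrm y.
Proof.
rewrite -(@ler_pXn2r _ 2)// ?nnegrE ?addr_ge0 ?nrm_ge0//.
rewrite sqrrD !sqr_nrm !(ipDl, ipDr) [ip y x]ipC.
have := cauchy_schwarz x y; rewrite ler_norml => /andP[_]; lra.
Qed.

Lemma nrmN x : nrm (- x) = nrm x.
Proof. by rewrite /nrm ipNl ipNr opprK. Qed.

(** For [u] close to [x] itself, [ip u x] is close to [nrm x ^+ 2]. *)
Lemma nrm_le_dense (D : set V) x a :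
  (forall y e, 0 < e -> exists2 u, D u & nrm (y - u) < e) -> 0 <= a ->
  (forall u, D u -> `|ip u x| <= a * nrm u) -> nrm x <= a.
Proof.
move=> hD a0 h; have [x0|x0] := leP (nrm x) 0; first exact: le_trans a0.
suff h2 : nrm x * nrm x <= a * nrm x by rewrite ler_pM2r in h2.
have K0 : 0 < nrm x + a by rewrite ltr_wpDr.
(* The distance from [u] to [x] enters twice, with the factors [nrm x] and [a]. *)
apply/ler_addgt0Pl => e e0; have [u Du xu] := hD x _ (divr_gt0 e0 K0).
rewrite -expr2 sqr_nrm -{1}[x](subrK u) ipDl.
have h1 : ip (x - u) x <= e / (nrm x + a) * nrm x.
  apply: le_trans (ler_norm _) (le_trans (cauchy_schwarz _ _) _).
  by rewrite ler_wpM2r ?nrm_ge0// ltW.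
have h2 : ip u x <= a * (e / (nrm x + a)) + a * nrm x.
  apply: le_trans (ler_norm _) (le_trans (h _ Du) _); rewrite -mulrDr ler_wpM2l//.
  have -> : u = - (x - u) + x by rewrite opprB subrK.
  by apply: le_trans (nrmD _ _) _; rewrite nrmN lerD2r ltW.
apply: le_trans (lerD h1 h2) _; rewrite addrA lerD2r.
by rewrite [a * _]mulrC -mulrDr divfK// gt_eqF.
Qed.

(* The rate makes a Cauchy sequence of L^2 converge almost everywhere, with no
   passage to a subsequence. *)
Definition rapidly_cauchy (f : nat -> V) := forall i j, (i <= j)%N ->
  ip (f i - f j) (f i - f j) <= 16^-1 ^+ i.

End preHilbert_theory.

(** The limit inherits the rate of the sequence up to a factor, and this factor lets the property
    pass to products. *)
Definition rapidly_complete (R : realType) (V : preHilbertType R) :=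
  forall f : nat -> V, rapidly_cauchy f ->
  exists l K, forall i, ip (f i - l) (f i - l) <= K * 16^-1 ^+ i.

(** * Riesz representation on a subspace *)

Section riesz.
Context {R : realType} {V : preHilbertType R}.
Variables (D : set V) (f : V -> R) (C : R).
Hypotheses (D0 : D 0) (DD : forall a x y, D x -> D y -> D (a *: x + y))
  (fD : forall a x y, D x -> D y -> f (a *: x + y) = a * f x + f y)
  (fC : forall x, D x -> `|f x| <= C * nrm x).

(* The representing vector is the limit of a minimising sequence of
   |x|^2 - 2 f x. *)
Lemma riesz : rapidly_complete V ->
  exists2 z, (forall x, D x -> f x = ip x z) &
    forall e, 0 < e -> exists2 u, D u & nrm (z - u) < e.
Proof.
move=> cV.
pose J x := ip x x - 2 * f x; pose m := inf (J @` D).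
have JC x : D x -> - C ^+ 2 <= J x.
  move=> Dx; have := fC Dx; rewrite /J -sqr_nrm ler_norml => /andP[_].
  have := sqr_ge0 (nrm x - C); nra.
have hJ : has_inf (J @` D).
  by split; [exists (J 0), 0 | exists (- C ^+ 2) => _ [x Dx <-]; exact: JC].
have mJ x : D x -> m <= J x.
  by move=> Dx; apply: ge_inf; [exact: hJ.2 | exists x].
(* By the parallelogram law the squared distance of [v i] and [v j] is at most
   [2 * dl i + 2 * dl j], hence at most [4 * dl i] for [i <= j]. *)
pose dl i : R := 4^-1 * 16^-1 ^+ i.
have dlp i : 0 < dl i by rewrite mulr_gt0// exprn_gt0.
have /choice[v vP] i : exists v, D v /\ J v < m + dl i.
  by have [_ [v Dv <-] vJ] := inf_adherent (dlp i) hJ; exists v.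
have cv : rapidly_cauchy v.
  move=> i j ij; have [Di Ji] := vP i; have [Dj Jj] := vP j.
  have dlij : dl j <= dl i.
    by rewrite ler_wpM2l// ler_wiXn2l//; lra.
  have Dh : D (2^-1 *: (v i + v j)).
    rewrite scalerDr; apply: DD => //.
    by rewrite -[_ *: _]addr0; apply: DD.
  have := mJ _ Dh; rewrite /J.
  have -> : f (2^-1 *: (v i + v j)) = 2^-1 * (f (v i) + f (v j)).
    have fZ x : D x -> f (2^-1 *: x) = 2^-1 * f x.
      have f0 : f 0 = 0 by have := fD 1 D0 D0; rewrite scaler0 addr0; lra.
      by move=> Dx; rewrite -[_ *: _]addr0 fD// f0 addr0.
    rewrite fZ; last by rewrite -[v i]scale1r; exact: DD.
    by rewrite -[v i]scale1r fD// mul1r scale1r.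
  move: Ji Jj dlij; rewrite /J /dl.
  rewrite !(ipBl, ipBr, ipZl, ipZr, ipDl, ipDr) [ip (v j) (v i)]ipC; lra.
have [z [K zK]] := cV v cv.
have K0 : 0 <= K.
  by have := le_trans (ip_ge0 _) (zK 0%N); rewrite expr0 mulr1.
exists z => [x Dx|e e0].
  pose N := ip x x + 1; have N0 : 0 < N by rewrite ltr_wpDl ?ip_ge0.
  (* [J] cannot fall more than [dl i] below [J (v i)]. Moving from [v i] along [x] by [- s / N]
     lowers [J] by at least [s ^+ 2 / N]; [N] exceeds [ip x x] by 1 to be nonzero. *)
  have sv i : (ip (v i) x - f x) ^+ 2 <= dl i * N.
    have [Di Ji] := vP i; pose s := ip (v i) x - f x.
    have := mJ _ (DD (- s / N) Dx Di); rewrite /J fD// !(ipDl, ipDr, ipZl, ipZr).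
    rewrite [ip x (v i)]ipC => h.
    have : 0 <= dl i - 2 * (s / N) * s + (s / N) ^+ 2 * ip x x.
      by move: h Ji; rewrite /J /s; lra.
    have -> : ip x x = N - 1 by rewrite /N addrK.
    have -> : s ^+ 2 = (s / N) ^+ 2 * N ^+ 2 by rewrite -exprMn divfK ?gt_eqF.
    have {2}-> : s = (s / N) * N by rewrite divfK ?gt_eqF.
    move: (s / N) (sqr_ge0 (s / N)) => r r0 h'.
    have : r ^+ 2 * N <= dl i by nra.
    by rewrite expr2 mulrA ler_pM2r.
  have zx i : (ip (v i) x - ip z x) ^+ 2 <= K * 16^-1 ^+ i * ip x x.
    rewrite -ipBl; apply: le_trans (ler_wpM2r (ip_ge0 x) (zK i)).
    rewrite -!sqr_nrm -exprMn -[leLHS]real_normK ?num_real//.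
    by rewrite lerXn2r ?nnegrE ?mulr_ge0 ?nrm_ge0//; exact: cauchy_schwarz.
  suff : (f x - ip x z) ^+ 2 = 0 by move/eqP; rewrite sqrf_eq0 subr_eq0 => /eqP.
  (* Both [f x] and [ip z x] are close to [ip (v i) x], and the square of a difference is at most
     twice the sum of the squares. *)
  apply: (@small_eq0 _ _ (2 * N + 2 * K * ip x x)).
    by rewrite addr_ge0 ?mulr_ge0 ?ip_ge0// ltW.
  have sixteen : (0 : R) < 16^-1 by [].
  move=> e /expr16_lt[i ie]; rewrite ger0_norm ?sqr_ge0//.
  have := sv i; have := zx i; rewrite [ip x z]ipC /dl.
  have : 0 <= (ip (v i) x - ip z x + (ip (v i) x - f x)) ^+ 2 by exact: sqr_ge0.
  have : 0 <= K * ip x x by rewrite mulr_ge0 ?ip_ge0.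
  move: (16^-1 ^+ i : R) (exprn_ge0 i (ltW sixteen)) ie => d d0 de q0 h1 h2 h3.
  have : d * (K * ip x x) <= e * (K * ip x x) by rewrite ler_wpM2r// ltW.
  have : d * N <= e * N by rewrite ler_wpM2r// ltW.
  have : 0 <= d * N by rewrite mulr_ge0// ltW.
  nra.
have e2 : 0 < e ^+ 2 / (K + 1) by rewrite divr_gt0 ?exprn_gt0// ltr_wpDl.
have [i ie] := expr16_lt e2; exists (v i); first exact: (vP i).1.
rewrite -(@ltr_pXn2r _ 2)// ?nnegrE ?nrm_ge0 ?(ltW e0)// sqr_nrm -opprB ipNl ipNr opprK.
apply: le_lt_trans (zK i) _; move: ie; rewrite ltr_pdivlMr ?ltr_wpDl//.
by apply: le_lt_trans; rewrite mulrC ler_wpM2l ?exprn_ge0 ?lerDl.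
Qed.

End riesz.

Lemma rapidly_complete_prod (R : realType) (V W : preHilbertType R) :
  rapidly_complete V -> rapidly_complete W -> rapidly_complete (V * W)%type.
Proof.
move=> cV cW f cf.
have [|l [K lK]] := cV (fst \o f).
  move=> i j /cf; apply: le_trans.
  by rewrite [leRHS]/(ip _ _ + ip _ _) lerDl ip_ge0.
have [|m [L mL]] := cW (snd \o f).
  move=> i j /cf; apply: le_trans.
  by rewrite [leRHS]/(ip _ _ + ip _ _) lerDr ip_ge0.
exists (l, m), (K + L) => i; rewrite mulrDl; exact: lerD (lK i) (mL i).
Qed.

(** * Skew-symmetric operators and localisation *)

Section skew_symmetry.
Context {R : realType}.
Implicit Types V W : preHilbertType R.

Lemma ip_pair V W (x y : V * W) : ip x y = ip x.1 y.1 + ip x.2 y.2.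
Proof. by []. Qed.

Definition skew_symmetric V (T : set (V * V)) :=
  forall x y, T x -> T y -> ip x.2 y.1 + ip x.1 y.2 = 0.

(** The form is the inner product of one pair with the other pair swapped, so it is continuous for
    the graph norm; limits are taken in one argument at a time. *)
Lemma skew_symmetric_closure V (T : set (V * V)) :
  skew_symmetric T -> skew_symmetric (opclosure T).
Proof.
move=> sT.
have swap (x y : V * V) : ip x.2 y.1 + ip x.1 y.2 = ip x (y.2, y.1).
  by rewrite ip_pair addrC.
have sTl x y : opclosure T x -> T y -> ip x.2 y.1 + ip x.1 y.2 = 0.
  move=> Tx Ty; rewrite swap; apply: (ip_approx_eq0 Tx) => u Tu.
  by rewrite -swap; exact: sT.
move=> x y Tx Ty; rewrite ipC [ip x.1 _]ipC addrC swap.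
apply: (ip_approx_eq0 Ty) => u Tu.
by rewrite -swap addrC ipC [ip u.2 _]ipC; exact: sTl.
Qed.

Lemma skew_symmetric_scale V a (T : set (V * V)) :
  skew_symmetric T -> skew_symmetric (opscale a T).
Proof.
move=> sT [x1 x2] [y1 y2] [x Tx /= ->] [y Ty /= ->].
by rewrite ipZl ipZr -mulrDr (sT _ _ Tx Ty) mulr0.
Qed.

Lemma skew_symmetric_add V (S T : set (V * V)) :
  skew_symmetric S -> skew_symmetric T -> skew_symmetric (opadd S T).
Proof.
move=> sS sT [x1 x2] [y1 y2] [u [v [/= Su Tv ->]]] [u' [v' [/= Su' Tv' ->]]].
rewrite ipDl ipDr addrACA.
by rewrite (sS _ _ Su Su') (sT _ _ Tv Tv') addr0.
Qed.

(** On the common domain of [T] and its adjoint, each term with [T] cancels one with [adj T];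
    closure and scaling preserve this. *)
Lemma skew_symmetric_opskew V (T : set (V * V)) : skew_symmetric (opskew T).
Proof.
apply: skew_symmetric_scale; apply: skew_symmetric_closure.
move=> [x1 x2] [y1 y2] [u [v [/= Tu [w Tw /= ->] ->]]].
move=> [u' [v' [/= Tu' [w' Tw' /= ->] ->]]].
have := Tw _ Tu'; have := Tw' _ Tu.
rewrite /= !(ipDl, ipDr, ipZl, ipZr) [ip u' _]ipC [ip y1 w]ipC; lra.
Qed.

(** The defining identity of [adj D], used once for each of the two pairs, cancels the four
    terms. *)
Lemma skew_symmetric_opskewblock V W (D : set (V * W)) :
  skew_symmetric (opskewblock D).
Proof.
move=> [[x1 x2] [x3 x4]] [[y1 y2] [y3 y4]].
move=> [[/= u Du ->] Dx] [[/= v Dv ->] Dy].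
have := Du _ Dy; have := Dv _ Dx.
rewrite !ip_pair /= ipZl ipZr [ip y4 _]ipC [ip y1 _]ipC; lra.
Qed.

Lemma skew_symmetric_sub_adj V (T : set (V * V)) :
  skew_symmetric T -> T `<=` opscale (-1) (adj T).
Proof.
move=> sT [x x'] Tx; exists (- x'); last by rewrite scaleN1r opprK.
by move=> [y y'] Ty /=; have := sT _ _ Ty Tx; rewrite /= ipNr; lra.
Qed.

(* Orthogonal projection onto the graph of [A], as in von Neumann's theorem. *)
Lemma adj_adj V (A : set (V * V)) : rapidly_complete V -> dd_closed A ->
  adj (adj A) `<=` A.
Proof.
move=> cV [[A0 AD _] _ Acl] x Ax.
have [||w wA wcl] := @riesz _ _ A (ip^~ x) (nrm x) A0 AD _ _
    (rapidly_complete_prod cV cV).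
- by move=> a u v _ _; rewrite ip_linear.
- by move=> u _; rewrite /= mulrC; exact: cauchy_schwarz.
have Aw : A w by exact: Acl.
suff -> : x = w by [].
pose d := x - w.
have dA u : A u -> ip u d = 0 by move=> Au; rewrite ipBr wA// subrr.
(* Orthogonality of [d] to the graph, read as membership in the adjoint. *)
have d1 : adj A (d.2, - d.1).
  by move=> u /dA; rewrite ip_pair ipNr => /eqP; rewrite addrC addr_eq0 => /eqP.
(* Both [x], in the double adjoint, and [w], in [A], can be paired with [(d.2, - d.1)]. The
   resulting identity has sides of opposite signs, so [d] vanishes. *)
have d2 : ip (- d.1) d.1 = ip d.2 d.2.
  have hx : ip (- d.1) x.1 = ip d.2 x.2 := Ax _ d1.
  have hw : ip w.2 d.2 = ip w.1 (- d.1) := d1 _ Aw.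
  have -> : ip (- d.1) d.1 = ip (- d.1) x.1 - ip (- d.1) w.1 := ipBr _ _ _.
  by rewrite hx [ip _ w.1]ipC -hw ipC -ipBl ipC.
have : ip d d = 0.
  have := ip_ge0 d.1; have := ip_ge0 d.2; move: d2; rewrite ip_pair ipNl; lra.
by move=> /ip_eq0 /eqP; rewrite subr_eq0 => /eqP.
Qed.

End skew_symmetry.

(** * Localisation of skew-selfadjointness *)

Section localisation.
Context {R : realType} {V : preHilbertType R}.
Variable A : set (V * V).
Hypotheses (cV : rapidly_complete V) (sA : skew_symmetric A) (Ac : dd_closed A).

Section cutoff.
Variable S : V -> V.
Hypotheses (Ssym : forall x y, ip (S x) y = ip x (S y))
  (Sdom : forall x, opdom A x -> opdom A (S x))
  (Scomm : continuous_op (opcomm S A)).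

Let opdom0 : opdom A 0.
Proof. by have [[A0 _ _] _ _] := Ac; exists 0. Qed.

Let opdom_lin a x y : opdom A x -> opdom A y -> opdom A (a *: x + y).
Proof.
by have [[_ AD _] _ _] := Ac => -[x' Ax] [y' Ay]; exists (a *: x' + y'); exact: AD Ax Ay.
Qed.

(** Linearity comes from symmetry alone: [S] moves to the other argument, and the inner product
    separates points. *)
Let Slin a x y : S (a *: x + y) = a *: S x + S y.
Proof. by apply: ipr_inj => z; rewrite Ssym !ip_linear !Ssym. Qed.

(* [g] is the bounded everywhere defined extension of [S A - A S]; it is
   symmetric because [A] is skew-symmetric and [S] is symmetric. *)
Lemma adj_cutoff : exists g : V -> V,
  (forall x y, ip (g x) y = ip x (g y)) /\
  forall x x', adj A (x, x') -> adj A (S x, g x + S x').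
Proof.
have [[A0 AD Afun] Adense _] := Ac.
have comm a : opdom A a -> exists w, opcomm S A (a, w).
  move=> Aa; have [z Sz] := Sdom Aa; case: Aa => y Aay.
  by exists (S y - z); exists y, z.
have comm_lin a u v w x : opcomm S A (u, v) -> opcomm S A (w, x) ->
    opcomm S A (a *: u + w, a *: v + x).
  move=> [y [z [/= Ay Az ->]]] [y' [z' [/= Ay' Az' ->]]].
  exists (a *: y + y'), (a *: z + z'); split; first exact: AD Ay Ay'.
    by rewrite Slin; exact: AD Az Az'.
  by rewrite Slin scalerBr addrACA opprD.
have comm_fun a v w : opcomm S A (a, v) -> opcomm S A (a, w) -> v = w.
  move=> [y [z [/= Ay Az ->]]] [y' [z' [/= Ay' Az' ->]]].
  by rewrite (Afun _ _ _ Ay Ay') (Afun _ _ _ Az Az').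
(* Symmetry of [S] moves it across; skew-symmetry of [A] is then applied to the pairs at [a] and
   [S b], and at [S a] and [b]. *)
have comm_sym a v b w : opcomm S A (a, v) -> opcomm S A (b, w) ->
    ip v b = ip a w.
  move=> [y [z [/= Ay Az ->]]] [y' [z' [/= Ay' Az' ->]]].
  rewrite ipBl ipBr Ssym -[ip a (S y')]Ssym.
  by have := sA Ay Az'; have := sA Az Ay'; rewrite /=; lra.
have /choice[F FP] a : exists w, opdom A a -> opcomm S A (a, w).
  by have [/comm[w ?]|?] := pselect (opdom A a); [exists w | exists 0].
have Flin a x y : opdom A x -> opdom A y -> F (a *: x + y) = a *: F x + F y.
  move=> Ax Ay; apply: comm_fun (FP _ _) (comm_lin a _ _ _ _ (FP _ Ax) (FP _ Ay)).
  exact: opdom_lin.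
have [C CP] := Scomm.
have FC a : opdom A a -> nrm (F a) <= C * nrm a by move=> /FP; exact: CP.
(* [g] is the adjoint of the commutator [F]: the functional [ip (F a) x] of [a] is bounded on the
   domain of [A], and Riesz represents it. *)
have /choice[g gP] x : exists g, forall a, opdom A a -> ip (F a) x = ip a g.
  have [||z zP _] := @riesz _ _ (opdom A) (fun a => ip (F a) x) (C * nrm x)
      opdom0 opdom_lin _ _ cV; last by exists z.
  - by move=> a y z Ay Az; rewrite Flin// ip_linear.
  - move=> y Ay; apply: (le_trans (cauchy_schwarz _ _)).
    by rewrite mulrAC ler_wpM2r ?nrm_ge0// FC.
exists g; split=> [x y|x x' Ax [a a'] Aa /=]; last first.
  (* With [z] the value of [A] at [S a], [S a'] is the commutator at [a] plus [z]; paired with [x],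
     the two parts give [ip a (g x)] and [ip (S a) x']. *)
  have [z Az] := Sdom (ex_intro _ _ Aa).
  have Ca : opcomm S A (a, S a' - z) by exists a', z.
  have Da : opdom A a by exists a'.
  rewrite ipDr -gP// (comm_fun _ _ _ (FP _ Da) Ca).
  by rewrite -!Ssym -(Ax _ Az)/= ipBl subrK.
(* Tested on [a] in the domain, the difference is [ip (F a) (z - b)] by [comm_sym]. In particular
   [g] extends [F]. The absolute value allows for a negative [C]. *)
have gF z b : opdom A b -> nrm (g z - F b) <= `|C| * nrm (z - b).
  move=> Ab; apply: (nrm_le_dense Adense); first by rewrite mulr_ge0 ?nrm_ge0.
  move=> a Aa; rewrite ipBr -gP// -(comm_sym _ _ _ _ (FP _ Aa) (FP _ Ab)) -ipBr.
  apply: (le_trans (cauchy_schwarz _ _)); rewrite mulrAC ler_wpM2r ?nrm_ge0//.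
  by apply: le_trans (FC _ Aa) _; rewrite ler_wpM2r ?nrm_ge0// ler_norm.
apply/eqP; rewrite -subr_eq0; apply/eqP.
apply: (@small_eq0 _ _ (nrm (g x) + nrm x * `|C|)).
  by rewrite addr_ge0 ?mulr_ge0 ?nrm_ge0.
move=> e e0; have [b Ab yb] := Adense y _ e0.
(* Symmetry holds when the second argument is [b] in the domain, since [ip (g x) b = ip x (F b)];
   both remainders are small when [b] is near [y]. *)
have -> : ip (g x) y - ip x (g y) = ip (g x) (y - b) - ip x (g y - F b).
  by rewrite !ipBr [ip (g x) b]ipC -(gP _ _ Ab) [ip (F b) x]ipC; ring.
apply: (le_trans (ler_normB _ _)); rewrite mulrDr lerD//.
  apply: (le_trans (cauchy_schwarz _ _)); rewrite mulrC ler_wpM2r ?nrm_ge0//.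
  exact: ltW.
apply: (le_trans (cauchy_schwarz _ _)); rewrite mulrCA ler_wpM2l ?nrm_ge0//.
by apply: le_trans (gF _ _ Ab) _; rewrite mulrC ler_wpM2r// ltW.
Qed.

End cutoff.

(** Both pairs lie in the range of [i] and pull back to [adj B]. By [B = - adj B] the second one,
    with its value negated, lies in [B], where the first can be tested on it. *)
Lemma adj_localised (U : preHilbertType R) (B : set (U * U)) (S : V -> V)
    (i : U -> V) x y u v :
  localisable A B S i -> (forall a b, ip (i a) (i b) = ip a b) ->
  skew_selfadjoint B ->
  adj A (S x, u) -> adj A (S y, v) -> ip u (S y) + ip (S x) v = 0.
Proof.
move=> L iso [_ Bskew] Ax Ay.
have [a _ ax] : range i (S x) by apply: (loc_range L); exists x.
have [b _ yb] : range i (S y) by apply: (loc_range L); exists y.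
have [c _ cu] : range i u by apply: (loc_adj_invariant L Ax); exists a.
have [d _ dv] : range i v by apply: (loc_adj_invariant L Ay); exists b.
have [E [_ EP]] := loc_extension L.
(* A pair [(t, t')] of [B] is replaced by the pair of [A] at [E t], whose components are projected
   back to [t] and [t'] by the adjoint of [i]. *)
have adjB e f : adj A (i e, i f) -> adj B (e, f).
  move=> ief [t t'] /EP[z [Az Et zt]] /=.
  rewrite ipC -(zt (e, i e) erefl) ipC (ief _ Az) /=.
  by rewrite ipC (Et (f, i f) erefl) ipC.
have Bac : adj B (a, c) by apply: adjB; rewrite ax cu.
have : B (b, - d).
  rewrite Bskew; exists d; last by rewrite scaleN1r.
  by apply: adjB; rewrite yb dv.
move=> /Bac /=; rewrite -yb -ax -cu -dv !iso ipNl.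
by rewrite [ip d a]ipC [ip b c]ipC; lra.
Qed.

Theorem skew_selfadjoint_localised (U1 U2 : preHilbertType R)
    (B1 : set (U1 * U1)) (B2 : set (U2 * U2)) (S1 S2 : V -> V)
    (i1 : U1 -> V) (i2 : U2 -> V) :
  localisable A B1 S1 i1 -> localisable A B2 S2 i2 ->
  (forall a b, ip (i1 a) (i1 b) = ip a b) ->
  (forall a b, ip (i2 a) (i2 b) = ip a b) ->
  (forall x y, ip (S1 x) y = ip x (S1 y)) -> (forall x, S2 x = x - S1 x) ->
  skew_selfadjoint B1 -> skew_selfadjoint B2 -> skew_selfadjoint A.
Proof.
move=> L1 L2 iso1 iso2 S1sym S2E B1skew B2skew.
have [g [gsym gP]] := adj_cutoff S1sym (loc_dom L1) (loc_comm L1).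
have adjB x x' y y' : adj A (x, x') -> adj A (y, y') -> adj A (x - y, x' - y').
  by move=> Ax Ay u Au; rewrite /= !ipBr (Ax _ Au) (Ay _ Au).
pose D := [set x | adj A x].
(* [T1] and [T2] are the cut-offs lifted to pairs; they map the graph [D] of the adjoint to itself,
   and [q1] holds for all pairs because [g] and [S1] are symmetric. *)
pose T1 (x : V * V) := (S1 x.1, g x.1 + S1 x.2).
pose T2 (x : V * V) := x - T1 x.
have D1 x : D x -> D (T1 x) by case: x => x x'; exact: gP.
have D2 x : D x -> D (T2 x).
  by case: x => x x' Dx; exact: adjB Dx (D1 _ Dx).
pose q (x y : V * V) := ip x.2 y.1 + ip x.1 y.2.
have q1 x y : q (T1 x) y = q x (T1 y).
  by rewrite /q /T1 /= !(ipDl, ipDr) gsym !S1sym; lra.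
have qBl x y z : q (x - y) z = q x z - q y z by rewrite /q /= !ipBl; lra.
have qBr x y z : q x (y - z) = q x y - q x z by rewrite /q /= !ipBr; lra.
have q2 x y : q (T2 x) y = q x (T2 y) by rewrite /T2 qBl qBr q1.
have q11 x y : D x -> D y -> q (T1 x) (T1 y) = 0.
  by move=> /D1 Dx /D1 Dy; exact: adj_localised L1 iso1 B1skew Dx Dy.
have q22 x y : D x -> D y -> q (T2 x) (T2 y) = 0.
  move=> /D2 Dx /D2 Dy.
  have T2E z : T2 z = (S2 z.1, z.2 - (g z.1 + S1 z.2)) by rewrite S2E.
  move: Dx Dy; rewrite !T2E => Dx Dy.
  exact: adj_localised L2 iso2 B2skew Dx Dy.
(* T1 T2 = T1^2 T2 + T1 T2^2, and q vanishes on both terms. *)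
have q12 x y : D x -> D y -> q (T1 x) (T2 y) = 0.
  move=> Dx Dy.
  have -> : q (T1 x) (T2 y) = q (T1 x) (T1 (T2 y)) + q (T1 x) (T2 (T2 y)).
    by rewrite [q _ (T2 (T2 y))]qBr addrC subrK.
  by rewrite (q11 _ _ Dx (D2 _ Dy)) add0r -q2; exact: (q22 _ _ (D1 _ Dx) Dy).
(* With all cut-offs moved to the second argument, [q] vanishes successively at [T1 (T1 y)], [T1 y]
   and [y]. *)
have q0 x y : D x -> D y -> q x y = 0.
  move=> Dx Dy; have := q11 _ _ Dx Dy; have := q22 _ _ Dx Dy.
  have := q12 _ _ Dx Dy; have := q12 _ _ Dy Dx.
  rewrite /T2 !(qBl, qBr) !q1; lra.
split => //; apply/seteqP; split; first exact: skew_symmetric_sub_adj.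
move=> [x x'] [z Az /= ->].
(* The vanishing of [q] on [D] says that minus the adjoint is contained in the double adjoint, hence
   in [A]. *)
apply: adj_adj => // -[y y'] Ay /=.
by rewrite scaleN1r ipNr; have := q0 _ _ Ay Az; rewrite /q /=; lra.
Qed.

End localisation.

(** * Completeness of the space of square-integrable forms *)

Section fip_theory.
Context {R : realType} {n : nat} {M : riemannian R n} {k : nat}.
Implicit Types (p : M) (u v w : {ffun k.-tuple 'I_n -> R}).

Lemma fipC p u v : fip p u v = fip p v u.
Proof. by have [P _ PE] := gmx_factor p; exact: gipC PE _ _. Qed.

Lemma fip_linear p a u v w : fip p (a *: u + v) w = a * fip p u w + fip p v w.
Proof. exact: gip_linear. Qed.

Lemma fip_ge0 p u : 0 <= fip p u u.
Proof. by have [P _ PE] := gmx_factor p; exact: gip_ge0 PE _. Qed.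

Lemma fip0 p v : fip p 0 v = 0.
Proof. by have := fip_linear p 1 0 0 v; rewrite scaler0 addr0; lra. Qed.

Lemma fipZ p a u v : fip p (a *: u) v = a * fip p u v.
Proof. by rewrite -[a *: u]addr0 fip_linear fip0 addr0. Qed.

Lemma fip_subC p u v : fip p (u - v) (u - v) = fip p (v - u) (v - u).
Proof. by rewrite -opprB -scaleN1r fipZ fipC fipZ mulN1r mulN1r opprK. Qed.

Lemma fip_cauchy_schwarz p u v : fip p u v ^+ 2 <= fip p u u * fip p v v.
Proof.
have [P Pu PE] := gmx_factor p.
have [/(gip_eq0 Pu PE) ->|v0] := eqVneq (fip p v v) 0.
  by rewrite fipC !fip0 expr0n mulr0.
have vp : 0 < fip p v v by rewrite lt_neqAle eq_sym v0 fip_ge0.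
have := fip_ge0 p (fip p v v *: u + - fip p u v *: v).
rewrite fip_linear fipZ [fip p u (_ + _)]fipC [fip p v (_ + _)]fipC !fip_linear.
rewrite !fipZ [fip p v u]fipC => h.
by rewrite -subr_ge0 -(pmulr_rge0 _ vp); nra.
Qed.

(** Multiplicativity of the k-th tensor power: the product of sums expands over functions, which are
    reindexed as tuples. *)
Lemma tensor_mulmx (A B : 'M[R]_n) (I J : k.-tuple 'I_n) :
  \prod_(a < k) (A *m B) (tnth I a) (tnth J a) =
  \sum_(K : k.-tuple 'I_n) (\prod_(a < k) A (tnth I a) (tnth K a)) *
    (\prod_(a < k) B (tnth K a) (tnth J a)).
Proof.
under eq_bigr do rewrite mxE.
rewrite bigA_distr_bigA /= [RHS](reindex (fun f : {ffun 'I_k -> 'I_n} => mktuple f)).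
  apply: eq_bigr => f _; rewrite big_split/=.
  by congr (_ * _); apply: eq_bigr => a _; rewrite tnth_mktuple.
exists (fun K => [ffun a => tnth K a]) => f _; last first.
  by apply: eq_from_tnth => a; rewrite tnth_mktuple ffunE.
by apply/ffunP => a; rewrite ffunE tnth_mktuple.
Qed.

(* Evaluation at [I] is the inner product with a tensor power of the metric. *)
Lemma coord_fip p (I : k.-tuple 'I_n) : exists v, forall u, u I = fip p u v.
Proof.
(* The factorial cancels the normalisation of [fip], and [gmx] inverts [ginv], leaving a Kronecker
   delta. *)
exists [ffun J => k`!%:R * \prod_(a < k) gmx p (tnth J a) (tnth I a)] => u.
rewrite /fip; under eq_bigr => K _.
  under eq_bigr do rewrite ffunE mulrCA mulrA.
  rewrite /=.
  have -> : \sum_(J : k.-tuple 'I_n) u K * (\prod_(a < k) ginv p (tnth K a) (tnth J a)) *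
      (k`!%:R * \prod_(a < k) gmx p (tnth J a) (tnth I a)) =
      k`!%:R * (u K * \prod_(a < k) (1%:M : 'M[R]_n) (tnth K a) (tnth I a)).
    rewrite -(mulVmx (_ : gmx p \in unitmx)); last first.
      by rewrite unitmxE unitfE gt_eqF// det_gmx_gt0.
    rewrite tensor_mulmx !mulr_sumr; apply: eq_bigr => J _; ring.
  over.
rewrite -mulr_sumr mulKf ?pnatr_eq0 -?lt0n ?fact_gt0//.
rewrite (bigD1 I)//= big1 ?mulr1 => [|a _]; last by rewrite mxE eqxx.
rewrite big1 ?addr0// => J JI; apply/eqP; rewrite mulf_eq0; apply/orP; right.
apply/prodf_eq0; have [a Ia] : exists a, tnth J a != tnth I a.
  by apply/existsP; apply: contraNT JI => /existsPn h;
     apply/eqP/eq_from_tnth => a; apply/eqP; have := h a; rewrite negbK.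
by exists a => //; rewrite mxE (negbTE Ia).
Qed.

End fip_theory.

Section L2_theory.
Context {R : realType} {n : nat} {M : riemannian R n} {G : opens M} {k : nat}.
Implicit Types (x y : L2 G k) (u v w : kform M k).

Let mG : measurable (opens_set G : set (borel M)).
Proof. by apply: open_borel; exact: opensP. Qed.

Lemma L2repr_section x : L2_section G (L2repr x).
Proof. by apply/asboolP; exact: L2valP. Qed.

Local Open Scope quotient_scope.

Lemma represents_inj x y w : represents x w -> represents y w -> x = y.
Proof.
move=> xw yw; rewrite -[x]reprK -[y]reprK; apply/eqmodP/asboolP.
by apply: almost_all2 xw yw => p h h' Gp; rewrite -[LHS]/(L2repr x p) h// -h'.
Qed.

Lemma represents_pi (u : L2sec G k) : represents (\pi_(L2 G k) u) (L2val u).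
Proof.
have /eqmodP/asboolP : \pi_(L2 G k) (repr (\pi_(L2 G k) u)) = \pi_(L2 G k) u.
  by rewrite reprK.
exact.
Qed.

Lemma represents_repr x : represents x (L2repr x).
Proof. exact: almost_allT. Qed.

Lemma represents_toL2 w : L2_section G w -> represents (toL2 G w) w.
Proof.
move=> Lw; have h := represents_pi (insubd (0 : L2sec G k) w).
by move: h; rewrite /toL2 insubdK//; apply/asboolP.
Qed.

Lemma represents_sub x y u v : represents x u -> represents y v ->
  represents (x - y) (u - v).
Proof.
move=> xu yv.
have hN : represents (- y) (- L2repr y) by exact: represents_pi.
have hD : represents (x - y) (L2repr x + L2repr (- y)) by exact: represents_pi.
have Nv : ae_eq_on G (L2repr (- y)) (- v).
  apply: almost_all2 hN yv => p h h' Gp; rewrite h//.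
  by congr (- _); exact: h'.
have xN : ae_eq_on G (L2repr x + L2repr (- y)) (u - v).
  apply: almost_all2 xu Nv => p h h' Gp.
  by congr (_ + _); [exact: h|exact: h'].
by apply: almost_all2 hD xN => p h h' Gp; rewrite h// h'.
Qed.

Lemma L2_section_sub u v : L2_section G u -> L2_section G v ->
  L2_section G (u - v).
Proof.
move=> Lu Lv; apply/asboolP.
rewrite -[X in is_true X]/(u - v \in L2_section_pred G (k := k)).
by apply: rpredB; apply/asboolP.
Qed.

Lemma measurable_sqr_fip u v :
  (forall I, measurable_fun (opens_set G : set (borel M)) (fun p => u p I)) ->
  (forall I, measurable_fun (opens_set G : set (borel M)) (fun p => v p I)) ->
  measurable_fun (opens_set G : set (borel M)) (fun p => (fip p (u p) (v p))%:E).
Proof. by move=> mu mv; apply/measurable_EFinP; exact: measurable_fip. Qed.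

Lemma ip_represents x y u v : represents x u -> represents y v ->
  L2_section G u -> L2_section G v ->
  ip x y = \int[vol M]_(p in opens_set G) fip p (u p) (v p).
Proof.
move=> xu yv [_ mu _] [_ mv _].
have [_ mx _] := L2repr_section x; have [_ my _] := L2repr_section y.
rewrite -[LHS]/(\int[vol M]_(p in opens_set G) fip p (L2repr x p) (L2repr y p)).
rewrite /Rintegral; congr fine; apply: ae_eq_integral => //.
- exact: measurable_sqr_fip.
- exact: measurable_sqr_fip.
by apply: almost_all2 xu yv => p h h' Gp; rewrite h// h'.
Qed.

Lemma integral_represents x u : represents x u -> L2_section G u ->
  (\int[vol M]_(p in opens_set G) (fip p (u p) (u p))%:E = (ip x x)%:E)%E.
Proof.
move=> xu Lu; rewrite (ip_represents xu xu Lu Lu) /Rintegral fineK//.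
rewrite ge0_fin_numE; first by case: Lu.
by apply: integral_ge0 => p _; rewrite lee_fin fip_ge0.
Qed.

End L2_theory.

(** The increments are at most [Num.sqrt K * 2^-1 ^+ i], so the telescoping series converges
    absolutely. *)
Lemma cvgn_sqr_diff_geometric (R : realType) (u : R^nat) (K : R) :
  (forall i, 4 ^+ i * (u i.+1 - u i) ^+ 2 <= K) -> cvgn u.
Proof.
move=> uK.
have -> : u = (fun n => u 0%N + series (telescope u) n).
  by apply/funext => n; rewrite -eq_sum_telescope.
apply: is_cvgD; first exact: is_cvg_cst.
apply: normed_cvg; apply: (@series_le_cvg _ _ (geometric (Num.sqrt K) 2^-1)).
- by move=> i; exact: normr_ge0.
- by move=> i; rewrite /geometric/= mulr_ge0 ?sqrtr_ge0 ?exprn_ge0.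
- move=> i; rewrite /geometric /= /telescope -sqrtr_sqr.
  have K0 : 0 <= K by apply: le_trans _ (uK i); rewrite mulr_ge0 ?sqr_ge0 ?exprn_ge0.
  have -> : 2^-1 ^+ i = Num.sqrt ((2^-1 ^+ i) ^+ 2) :> R.
    by rewrite sqrtr_sqr ger0_norm ?exprn_ge0.
  rewrite -sqrtrM//; apply: ler_wsqrtr.
  have := uK i; rewrite exprAC (_ : 2^-1 ^+ 2 = 4^-1 :> R); last by lra.
  by rewrite exprVn ler_pdivlMr ?exprn_gt0// mulrC.
- by apply: is_cvg_geometric_series; rewrite ger0_norm ?invf_lt1 ?ltr1n.
Qed.

(** * Riesz-Fischer theorem *)

Section L2_complete.
Context {R : realType} {n : nat} {M : riemannian R n} {G : opens M} {k : nat}.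
Variable f : nat -> L2 G k.
Hypothesis cf : rapidly_cauchy f.

Let mG : measurable (opens_set G : set (borel M)).
Proof. by apply: open_borel; exact: opensP. Qed.

Let u i := L2repr (f i).

Let sq i j (p : M) : R := fip p (u i p - u j p) (u i p - u j p).

Let sq_ge0 i j p : 0 <= sq i j p.
Proof. exact: fip_ge0. Qed.

Let section_sub i j : L2_section G (u i - u j).
Proof. by apply: L2_section_sub; exact: L2repr_section. Qed.

Let measurable_sq i j :
  measurable_fun (opens_set G : set (borel M)) (fun p => (sq i j p)%:E).
Proof. by have [_ h _] := section_sub i j; exact: measurable_sqr_fip. Qed.

Let integral_sq i j : (i <= j)%N ->
  (\int[vol M]_(p in opens_set G) (sq i j p)%:E <= (16^-1 ^+ i)%:E)%E.
Proof.
move=> ij.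
have h : represents (f i - f j) (u i - u j).
  by apply: represents_sub; exact: represents_repr.
have -> := integral_represents h (section_sub i j).
by rewrite lee_fin cf.
Qed.

(** The weight [4 ^+ i] leaves integrals of at most [4^-1 ^+ i], which are summable, while
    finiteness of [S p] forces geometric decay of the increments at [p]. *)
Let S (p : M) : \bar R := (\sum_(0 <= i <oo) (4 ^+ i * sq i i.+1 p)%:E)%E.

Let term_ge0 i p : (0 <= (4 ^+ i * sq i i.+1 p)%:E)%E.
Proof. by rewrite lee_fin mulr_ge0 ?exprn_ge0. Qed.

Let measurable_term i : measurable_fun (opens_set G : set (borel M))
  (fun p => (4 ^+ i * sq i i.+1 p)%:E).
Proof.
under eq_fun do rewrite EFinM; apply: measurable_funeM; exact: measurable_sq.
Qed.

Let measurable_S : measurable_fun (opens_set G : set (borel M)) S.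
Proof. by apply: ge0_emeasurable_sum => // i p _ _; exact: term_ge0. Qed.

Let integral_S : (\int[vol M]_(p in opens_set G) S p <= 2%:E)%E.
Proof.
rewrite integral_nneseries//.
have h i : (\int[vol M]_(p in opens_set G) (4 ^+ i * sq i i.+1 p)%:E <=
    (4^-1 ^+ i)%:E)%E.
  under eq_integral do rewrite EFinM.
  rewrite ge0_integralZl_EFin ?exprn_ge0//; last first.
    by move=> p _; rewrite lee_fin.
 
  apply: le_trans (lee_wpmul2l _ (integral_sq (leqnSn i))) _.
    by rewrite lee_fin exprn_ge0.
  rewrite -EFinM lee_fin -exprMn (_ : 4 * 16^-1 = 4^-1 :> R)//; lra.
apply: lime_le.
  apply: is_cvg_nneseries => i _ _; apply: integral_ge0 => p _; exact: term_ge0.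
apply: nearW => N; apply: (@le_trans _ _ (\sum_(0 <= i < N) 4^-1 ^+ i)%:E).
  by rewrite -sumEFin; apply: lee_sum => i _; exact: h.
(* The extra term makes the bound inductive. *)
rewrite lee_fin; suff : \sum_(0 <= i < N) 4^-1 ^+ i + 2 * 4^-1 ^+ N <= 2 :> R.
  by apply: le_trans; rewrite lerDl mulr_ge0 ?exprn_ge0.
elim: N => [|N IH]; first by rewrite big_geq// expr0; lra.
rewrite big_nat_recr//= exprS.
have : 0 <= 4^-1 ^+ N :> R by rewrite exprn_ge0.
by move: IH; lra.
Qed.

Let good (p : M) := (S p < +oo)%E.

Let ae_good : almost_all (fun p => opens_set G p -> good p).
Proof.
have : (vol M).-integrable (opens_set G) S.
  apply/integrableP; split=> //.
  under eq_integral => p _ do rewrite gee0_abs ?nneseries_ge0//.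
  by apply: le_lt_trans integral_S _; rewrite ltry.
move=> /(integrable_ae mG); apply: almost_allS => p h Gp.
by have := h Gp; rewrite fin_numE /good ltey => /andP[].
Qed.

(** Cutting off outside [good] changes [u i] only on a null set of [G] and makes the sequence
    converge at every point. *)
Let v i : kform M k := fun p => if good p then u i p else 0.

Let measurable_v i I :
  measurable_fun (opens_set G : set (borel M)) (fun p => v i p I).
Proof.
have -> : (fun p => v i p I) = (fun p => if good p then u i p I else 0).
  by apply/funext => p; rewrite /v; case: ifP => //; rewrite ffunE.
apply: measurable_fun_if => //.
- by apply: measurable_fun_lte => //; exact: measurable_cst.
- have [_ mu _] := L2repr_section (f i); exact: measurable_funS (mu I).
Qed.

(** A coordinate is an inner product with a fixed covector, so Cauchy-Schwarz bounds its weighted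
    squared increments by a multiple of [S p]. *)
Let cvg_v p I : cvgn (fun i => v i p I).
Proof.
rewrite /v; have [gp|_] := boolP (good p); last exact: is_cvg_cst.
have [w wP] := coord_fip p I.
apply: (@cvgn_sqr_diff_geometric _ _ (fine (S p) * fip p w w)) => i.
have -> : u i.+1 p I - u i p I = - (u i p - u i.+1 p) I.
  by rewrite !ffunE opprB.
rewrite sqrrN wP; apply: le_trans (ler_wpM2l _ (fip_cauchy_schwarz _ _ _)) _.
  by rewrite exprn_ge0.
rewrite mulrA ler_wpM2r ?fip_ge0// -lee_fin fineK; last first.
  by rewrite ge0_fin_numE// nneseries_ge0.
apply: le_trans (nneseries_lim_ge i.+1 _) => //.
by rewrite big_nat_recr//= leeDr// sume_ge0.
Qed.

Let w : kform M k := fun p => [ffun I => limn (fun i => v i p I)].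

Let cvg_w p I : v i p I @[i --> \oo] --> w p I.
Proof. by rewrite ffunE; exact: cvg_v. Qed.

Let cvg_fip p i :
  fip p (v j p - u i p) (v j p - u i p) @[j --> \oo] -->
  fip p (w p - u i p) (w p - u i p).
Proof.
have h K : (v j p - u i p) K @[j --> \oo] --> (w p - u i p) K.
  rewrite sub_ffunE; under eq_cvg do rewrite sub_ffunE.
  by apply: cvgD; [exact: cvg_w|exact: cvg_cst].
apply: cvgM; first exact: cvg_cst.
apply: cvg_big => [|I _]; first exact: add_continuous.
apply: cvg_big => [|J _]; first exact: add_continuous.
by apply: cvgM; [exact: cvg_cst|apply: cvgM].
Qed.

Let measurable_w I :
  measurable_fun (opens_set G : set (borel M)) (fun p => w p I).
Proof.
exact: (@measurable_fun_cvg _ (borel M) R (opens_set G)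
  (fun i p => v i p I)).
Qed.

Let alternating_w : alternating_on G w.
Proof.
move=> p I s Gp; set J := [tuple tnth I (s a) | a < k].
have h i : v i p J = (-1) ^+ s * v i p I.
  have [au _ _] := L2repr_section (f i).
  by rewrite /v; case: ifP => _; [exact: au|rewrite !ffunE mulr0].
have hw : v i p J @[i --> \oo] --> (-1) ^+ s * w p I.
  under eq_cvg do rewrite h.
  by apply: cvgM; [exact: cvg_cst|exact: cvg_w].
exact: (cvg_unique _ (@cvg_w p J) hw).
Qed.

(** Fatou's lemma in [j]: the integrand is the limit of the squared distances of [v j] and [u i],
    whose integrals are bounded as soon as [i <= j]. *)
Let integral_w i : (\int[vol M]_(p in opens_set G)
  (fip p (w p - u i p) (w p - u i p))%:E <= (16^-1 ^+ i)%:E)%E.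
Proof.
pose h j (p : M) := (fip p (v j p - u i p) (v j p - u i p))%:E.
have mh j : measurable_fun (opens_set G : set (borel M)) (h j).
  have [_ mu _] := L2repr_section (f i).
  have m I : measurable_fun (opens_set G : set (borel M)) (fun p => (v j p - u i p) I).
    under eq_fun do rewrite sub_ffunE.
    by apply: measurable_funB => //; exact: mu.
  exact: measurable_sqr_fip.
have h0 j p : (0 <= h j p)%E by rewrite lee_fin fip_ge0.
rewrite (_ : (\int[vol M]_(p in opens_set G) _)%E =
    (\int[vol M]_(p in opens_set G) limn_einf (h ^~ p))%E); last first.
  apply: eq_integral => p _.
  have : h j p @[j --> \oo] --> (fip p (w p - u i p) (w p - u i p))%:E.
    by apply: cvg_EFin; [exact: nearW|exact: cvg_fip].
  by move=> /cvg_limn_einf_sup[].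
apply: le_trans (fatou (vol M) mG mh (fun j p _ => h0 j p)) _.
have hj j : (i <= j)%N ->
    (\int[vol M]_(p in opens_set G) h j p <= (16^-1 ^+ i)%:E)%E.
  move=> ij; rewrite (_ : (\int[vol M]_(p in opens_set G) h j p)%E =
      (\int[vol M]_(p in opens_set G) (sq i j p)%:E)%E); first exact: integral_sq.
  apply: ge0_ae_eq_integral => //; first by move=> p _; rewrite lee_fin.
  apply: almost_allS ae_good => p gp Gp.
  by rewrite /h /v gp// /sq fip_subC.
rewrite limn_einf_lim; apply: lime_le; first exact: is_cvg_einfs.
near=> j; apply: le_trans (hj j _); last by near: j; exact: nbhs_infty_ge.
by apply: ereal_inf_lbound; exists j => /=.
Unshelve. all: by end_near. Qed.

Lemma rapidly_cauchy_L2 :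
  exists l, forall i, ip (f i - l) (f i - l) <= 16^-1 ^+ i.
Proof.
have [au mu _] := L2repr_section (f 0%N).
(* Square-integrability of [w] is obtained by adding [u 0] to this difference, which [integral_w]
   controls. *)
have Lw0 : L2_section G (w - u 0%N).
  split.
  - move=> p I s Gp; rewrite !(sub_ffunE (w p) (u 0%N p)) mulrBr.
    by congr (_ - _); [exact: alternating_w|exact: au].
  - move=> I; have -> : (fun p => (w - u 0%N) p I) = (fun p => w p I - u 0%N p I).
      by apply/funext => p; exact: (sub_ffunE (w p) (u 0%N p)).
    by apply: measurable_funB; [exact: measurable_w|exact: mu].
  - by apply: le_lt_trans (integral_w 0) _; rewrite ltry.
have Lw : L2_section G w.
  have -> : w = (w - u 0%N) + u 0%N by rewrite subrK.
  apply/asboolP.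
  rewrite -[X in is_true X]/((w - u 0%N) + u 0%N \in L2_section_pred G (k := k)).
  by apply: rpredD; apply/asboolP => //; exact: L2repr_section.
exists (toL2 G w) => i.
have h : represents (f i - toL2 G w) (u i - w).
  by apply: represents_sub; [exact: represents_repr|exact: represents_toL2].
have Lh : L2_section G (u i - w).
  by apply: L2_section_sub => //; exact: L2repr_section.
rewrite -lee_fin -(integral_represents h Lh).
under eq_integral => p _ do rewrite (fip_subC p (u i p) (w p)).
exact: integral_w.
Qed.

End L2_complete.

(** * Multiplication and extension operators *)

Section L2_operators.
Context {R : realType} {n : nat} {M : riemannian R n} {k : nat}.

Lemma rapidly_complete_L2 (G : opens M) : rapidly_complete (L2 G k).
Proof.
move=> f /rapidly_cauchy_L2[l lP]; exists l, 1 => i; rewrite mul1r; exact: lP.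
Qed.

Lemma smooth_fun_continuous (G : opens M) (f : M -> R) p :
  smooth_fun (opens_set G) f -> opens_set G p -> {for p, continuous f}.
Proof.
move=> sf Gp; have jp := atpP p; set j := atp p in jp.
(* The empty list of derivatives gives continuity in the chart, which is then composed with the
   chart map. *)
have [|cf _] := sf j [::] (chart (charts M) j p); first by exists p.
have : {for p, continuous ((f \o cinv (charts M) j) \o chart (charts M) j)}.
  by apply: continuous_comp => //; exact: chart_continuous.
rewrite /prop_for /continuous_at /= chartK// => h; apply: cvg_trans h.
apply: near_eq_cvg; near=> q; rewrite /= chartK//.
by near: q; apply: open_nbhs_nbhs; split => //; exact: cdom_open.
Unshelve. all: by end_near. Qed.

Lemma smooth_fun_measurable (G : opens M) (f : M -> R) :
  smooth_fun (opens_set G) f ->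
  measurable_fun (opens_set G : set (borel M)) f.
Proof.
move=> sf; apply: open_continuous_borel; first exact: opensP.
by move=> p Gp; exact: smooth_fun_continuous sf Gp.
Qed.

Section mulop.
Variables (G : opens M) (f : M -> R).
Hypotheses (mf : measurable_fun (opens_set G : set (borel M)) f)
  (f1 : forall p, opens_set G p -> `|f p| <= 1).

(** [toL2] sends a section that is not square-integrable to 0, so this is what makes [mulop f] a
    true multiplication. *)
Lemma L2_section_mul (w : kform M k) : L2_section G w ->
  L2_section G (fun p => f p *: w p).
Proof.
move=> [aw mw iw].
have mfw I : measurable_fun (opens_set G : set (borel M)) (fun p => (f p *: w p) I).
  under eq_fun do rewrite ffunE; apply: measurable_funM => //; exact: mw.
split => //.
  by move=> p I s Gp; rewrite !ffunE aw// mulrCA.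
apply: le_lt_trans iw; apply: ge0_le_integral => //.
- by apply: open_borel; exact: opensP.
- by move=> p _; rewrite lee_fin fip_ge0.
- by apply: measurable_sqr_fip.
- by apply: measurable_sqr_fip.
move=> p Gp; rewrite lee_fin fipZ fipC fipZ mulrA ler_piMl ?fip_ge0// -expr2.
by rewrite -real_normK ?num_real// expr_le1 ?f1.
Qed.

Lemma represents_mulop (x : L2 G k) :
  represents (mulop f x) (fun p => f p *: L2repr x p).
Proof. by apply/represents_toL2/L2_section_mul; exact: L2repr_section. Qed.

Lemma mulop_symmetric (x y : L2 G k) : ip (mulop f x) y = ip x (mulop f y).
Proof.
have Lx := L2_section_mul (L2repr_section x).
have Ly := L2_section_mul (L2repr_section y).
rewrite (ip_represents (represents_mulop x) (represents_repr y) Lx)//; last first.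
  exact: L2repr_section.
rewrite (ip_represents (represents_repr x) (represents_mulop y) _ Ly); last first.
  exact: L2repr_section.
by apply: eq_Rintegral => p _; rewrite fipZ [RHS]fipC fipZ [in RHS]fipC.
Qed.

End mulop.

Lemma mulop_compl (G : opens M) (f : M -> R) (x : L2 G k) :
  measurable_fun (opens_set G : set (borel M)) f ->
  (forall p, opens_set G p -> 0 <= f p <= 1) ->
  mulop (fun p => 1 - f p) x = x - mulop f x.
Proof.
move=> mf f01.
have f1 p : opens_set G p -> `|f p| <= 1.
  by move=> /f01 /andP[f0 fle]; rewrite ger0_norm.
have f2 p : opens_set G p -> `|1 - f p| <= 1.
  by move=> /f01 /andP[f0 fle]; rewrite ger0_norm ?subr_ge0// gerBl.
have mf2 : measurable_fun (opens_set G : set (borel M)) (fun p => 1 - f p).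
  by apply: measurable_funB.
apply: represents_inj (represents_mulop mf2 f2 x) _.
have := represents_sub (represents_repr x) (represents_mulop mf f1 x).
by apply: almost_allS => p h Gp; rewrite h// scalerBl scale1r.
Qed.

Section ext0.
Variables (G Om : opens M).
Hypothesis GOm : opens_set G `<=` opens_set Om.

Let ext (w : kform M k) : kform M k :=
  fun p => if `[< opens_set G p >] then w p else 0.

Lemma integral_ext (u v : kform M k) :
  (\int[vol M]_(p in opens_set Om) (fip p (ext u p) (ext v p))%:E =
   \int[vol M]_(p in opens_set G) (fip p (u p) (v p))%:E)%E.
Proof.
rewrite integral_mkcond [RHS]integral_mkcond; apply: eq_integral => p _.
rewrite !patchE /ext; case: asboolP => Gp.
  by rewrite !mem_set//; exact: GOm.
rewrite fip0 (memNset Gp); by case: ifP.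
Qed.

Lemma L2_section_ext0 (w : kform M k) : L2_section G w -> L2_section Om (ext w).
Proof.
move=> [aw mw iw]; split.
- move=> p I s _; rewrite /ext; case: asboolP => [Gp|_]; first exact: aw.
  by rewrite !ffunE mulr0.
- move=> I; have -> : (fun p => ext w p I) =
      (fun p => if `[< opens_set G p >] then w p I else 0).
    by apply/funext => p; rewrite /ext; case: ifP => //; rewrite ffunE.
  (* As a [patch], the extension is measurable on [Om] once [w] is measurable on the intersection of
     [Om] and [G], which is [G]. *)
  have -> : (fun p => if `[< opens_set G p >] then w p I else 0) =
      patch (fun=> point) (opens_set G) (fun p => w p I).
    by apply/funext => p; rewrite patchE; congr (if _ then _ else _).
  apply/(measurable_restrict (T1 := borel M)); first by apply: open_borel; exact: opensP.
    by apply: open_borel; exact: opensP.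
  by rewrite setIidr//; exact: mw.
- by rewrite integral_ext.
Qed.

Lemma ext0_isometric (x y : L2 G k) : ip (ext0 Om x) (ext0 Om y) = ip x y.
Proof.
have Lx := L2_section_ext0 (L2repr_section x).
have Ly := L2_section_ext0 (L2repr_section y).
rewrite (ip_represents (represents_toL2 Lx) (represents_toL2 Ly) Lx Ly).
by rewrite /Rintegral integral_ext.
Qed.

End ext0.
End L2_operators.

(** * Application to the operators on forms *)

Theorem theorem4p20 (R : realType) (n k : nat) (M : riemannian R n)
    (Om Omt Omh : opens M) (X0 : vfield M) (alpha phi : M -> R)
    (M0 M1 : Hs Om k -> Hs Om k) (c : R)
    (n_odd : odd n) (k_range : (1 <= k < n)%N)
    (Om_cover : opens_set Om = opens_set Omh `|` opens_set Omt)
    (M0_bounded : bounded_linear M0) (M1_bounded : bounded_linear M1)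
    (M0_local : local_op M0) (M1_local : local_op M1)
    (M0_selfadjoint : forall x y, ip (M0 x) y = ip x (M0 y))
    (c_gt0 : 0 < c) (M0_ge : forall x, c * ip x x <= ip (M0 x) x)
    (X0_smooth : smooth_vfield [set: M] X0)
    (X0_supp : vsupp X0 `<=` opens_set Omt)
    (X0_vanish : forall p, opens_set Omh p -> X0 p = 0)
    (alpha_bounded : L_infty Om alpha)
    (alpha_supp : ess_supp_in Om alpha `<=` opens_set Omt)
    (alpha_vanish : almost_all (fun p => opens_set Omh p -> alpha p = 0))
    (hyp_t : lie_hypotheses (k := k) X0 alpha (restr_op Omt M0))
    (hyp_h : lie_hypotheses (k := k) X0 alpha (restr_op Omh M0))
    (phi_smooth : smooth_fun (opens_set Om) phi)
    (phi_range : forall p, opens_set Om p -> 0 <= phi p <= 1)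
    (phi_supp : supp_in Om phi `<=` opens_set Omt)
    (X0_phi : vsupp X0 `<=` [set p | opens_set Om p /\ phi p = 1])
    (loc_1 : localisable (opA X0 alpha M0) (opB1 Omt X0 alpha M0)
       (mulopH phi) (ext0H (G := Omt) Om (k := k)))
    (loc_2 : localisable (opA X0 alpha M0) (opB2 Omh k)
       (mulopH (fun p => 1 - phi p)) (ext0H (G := Omh) Om (k := k)))
    (B1_skew : skew_selfadjoint (opB1 Omt X0 alpha M0))
    (B2_skew : skew_selfadjoint (opB2 Omh k)) :
  skew_selfadjoint (opA X0 alpha M0).
Proof.
have mphi := smooth_fun_measurable phi_smooth.
have phi1 p : opens_set Om p -> `|phi p| <= 1.
  by move=> /phi_range /andP[p0 p1]; rewrite ger0_norm.
apply: (skew_selfadjoint_localised _ _ (loc_A loc_1) loc_1 loc_2) => //.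
- by apply: rapidly_complete_prod; exact: rapidly_complete_L2.
(* Skew-symmetry of [opA] is formal: it holds for the skew part of any operator and for any block
   [opskewblock]. *)
- apply: skew_symmetric_closure; apply: skew_symmetric_add.
    exact: skew_symmetric_opskew.
  exact: skew_symmetric_opskewblock.
- move=> x y; rewrite [LHS]ip_pair [RHS]ip_pair.
  by rewrite !ext0_isometric// Om_cover; exact: subsetUr.
- move=> x y; rewrite [LHS]ip_pair [RHS]ip_pair.
  by rewrite !ext0_isometric// Om_cover; exact: subsetUl.
- by move=> x y; rewrite !ip_pair /= !mulop_symmetric.
- by move=> x; rewrite /mulopH !mulop_compl//; case: x.
Qed.
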